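(* The following are equivalent for a countable ring $R$: (1) there exists an uncountable Polish $R$-module that is projective as an $R$-module; (2) there is an irreducible idempotent $e\in R$ such that the projective module $Re$ is of finite length as a right $eRe$-module, with the action given by multiplication; (3) there is an irreducible idempotent $e\in R$ such that the corner ring $eRe$ is right artinian and the right $eRe$-module $Re$ is of finite length; (4) there is a nonzero idempotent $e\in R$ such that the corner ring $eRe$ is a left $F$-ring and $Re$ is a finitely presented right $eRe$-module.
   Context: Rings have an identity $1\neq 0$; modules are unital left modules unless stated otherwise; $R$ is given the discrete topology. A Polish $R$-module is an $R$-module $A$ with a separable completely metrizable topology for which $(A,+,-,0)$ is a topological group and scalar multiplication $R\times A\to A$ is continuous. An idempotent $e$ ($e^2=e$) is irreducible (or primitive) if it is nonzero and cannot be written as a sum of two nonzero orthogonal idempotents, where idempotents $e,f$ are orthogonal if $ef=fe=0$. For an idempotent $e\ne 0$, the corner ring $eRe$ has identity $e$. A ring $S$ is a (left) $F$-ring if the left $S$-module $({}_SS)^{\omega}$ (the direct product of countably many copies of the left regular module) is free. *)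

(* Defs.v *)
From HB Require Import structures.
From mathcomp Require Import all_boot all_order all_algebra.
From mathcomp Require Import boolp classical_sets functions cardinality reals.
From mathcomp Require Import topology normedtype.

Set Implicit Arguments.
Unset Strict Implicit.
Unset Printing Implicit Defensive.

Import Order.TTheory GRing.Theory Num.Theory.

Local Open Scope classical_set_scope.
Local Open Scope ring_scope.

(* All modules are left modules (lmodType); a right S-module is a left module
   over the converse ring S^c. *)

Section Modules.
Variable S : nzRingType.

Definition submodule (M : lmodType S) (N : {pred M}) : Prop :=
  GRing.submod_closed N.

(* N is a maximal proper submodule of P, that is, P / N is simple. *)
Definition maximal_submodule (M : lmodType S) (N P : {pred M}) : Prop :=
  [/\ {subset N <= P}, ~ {subset P <= N} &
    forall L : {pred M}, submodule L -> {subset N <= L} -> {subset L <= P} ->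
      L =i N \/ L =i P].

Definition finite_length (M : lmodType S) : Prop :=
  exists (n : nat) (N : nat -> {pred M}),
    [/\ forall i, submodule (N i), N 0%N =i pred1 (0 : M), N n =i predT &
      forall i, (i < n)%N -> maximal_submodule (N i) (N i.+1)].

Definition artinian (M : lmodType S) : Prop :=
  forall N : nat -> {pred M}, (forall i, submodule (N i)) ->
    (forall i, {subset N i.+1 <= N i}) ->
    exists n, forall m, (n <= m)%N -> N m =i N n.

Definition finitely_presented (M : lmodType S) : Prop :=
  exists (m n : nat) (g : {linear 'rV[S]_m -> 'rV[S]_n})
         (f : {linear 'rV[S]_n -> M}),
    (forall y, exists x, f x = y) /\
    (forall x, f x = 0 <-> exists z, g z = x).

Definition projective (P : lmodType S) : Prop :=
  forall (M N : lmodType S) (g : {linear M -> N}) (f : {linear P -> N}),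
    (forall y, exists x, g x = y) ->
    exists h : {linear P -> M}, forall x, g (h x) = f x.

Definition is_basis (M : lmodType S) (B : set M) : Prop :=
  (forall (s : seq M) (c : M -> S), uniq s -> (forall x, x \in s -> B x) ->
     \sum_(x <- s) c x *: x = 0 -> forall x, x \in s -> c x = 0) /\
  (forall y, exists (s : seq M) (c : M -> S),
     (forall x, x \in s -> B x) /\ y = \sum_(x <- s) c x *: x).

Definition free_module (M : lmodType S) : Prop := exists B : set M, is_basis B.

End Modules.

Definition right_artinian (S : nzRingType) : Prop := artinian (S^c)^o.

Definition left_F_ring (S : nzRingType) : Prop :=
  free_module (nat -> S^o : lmodType S).

Section Idempotents.
Variable R : nzRingType.

Definition is_idempotent (e : R) : Prop := e * e = e.

Definition orthogonal_idempotents (f g : R) : Prop :=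
  [/\ is_idempotent f, is_idempotent g, f * g = 0 & g * f = 0].

Definition irreducible_idempotent (e : R) : Prop :=
  [/\ is_idempotent e, e <> 0 &
    ~ exists f g : R,
        [/\ orthogonal_idempotents f g, f <> 0, g <> 0 & e = f + g]].

Record nzidempotent := NzIdempotent {
  idem_val :> R;
  idemP : is_idempotent idem_val;
  idem_neq0 : idem_val <> 0 }.

End Idempotents.

Section Corner.
Variables (R : nzRingType) (e : nzidempotent R).

Definition corner_pred : {pred R} :=
  [pred x | `[< exists r : R, x = (e : R) * r * (e : R) >]].

Record corner := Corner { corner_val :> R; _ : corner_val \in corner_pred }.

HB.instance Definition _ := [isSub for corner_val].
HB.instance Definition _ := [Choice of corner by <:].

Fact corner_zmod_closed : zmod_closed corner_pred.
Proof.
split=> [|_ _ /asboolP[r ->] /asboolP[s ->]]; apply/asboolP.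
  by exists 0; rewrite mulr0 mul0r.
by exists (r - s); rewrite mulrBr mulrBl.
Qed.
HB.instance Definition _ :=
  GRing.isZmodClosed.Build R corner_pred corner_zmod_closed.
HB.instance Definition _ := [SubChoice_isSubZmodule of corner by <:].

Fact corner_valP (x : corner) :
  exists r : R, (x : R) = (e : R) * r * (e : R).
Proof. by case: x => x /= /asboolP. Qed.

Fact corner_mul_subproof (x y : corner) :
  (x : R) * (y : R) \in corner_pred.
Proof.
have [[r ->] [s ->]] := (corner_valP x, corner_valP y); apply/asboolP.
by exists (r * (e : R) * (e : R) * s); rewrite !mulrA.
Qed.
Definition corner_mul (x y : corner) : corner :=
  Corner (corner_mul_subproof x y).

Fact corner_one_subproof : (e : R) \in corner_pred.
Proof. by apply/asboolP; exists 1; rewrite mulr1 (idemP e). Qed.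
Definition corner_one : corner := Corner corner_one_subproof.

Fact corner_mulA : associative corner_mul.
Proof. by move=> x y z; apply/val_inj; rewrite /= mulrA. Qed.
Fact corner_mul1 : left_id corner_one corner_mul.
Proof.
move=> x; apply/val_inj; rewrite /=; have [r ->] := corner_valP x.
by rewrite !mulrA (idemP e).
Qed.
Fact corner_mulr1 : right_id corner_one corner_mul.
Proof.
move=> x; apply/val_inj; rewrite /=; have [r ->] := corner_valP x.
by rewrite -!mulrA (idemP e).
Qed.
Fact corner_mulDl : left_distributive corner_mul +%R.
Proof. by move=> x y z; apply/val_inj; rewrite /= mulrDl. Qed.
Fact corner_mulDr : right_distributive corner_mul +%R.
Proof. by move=> x y z; apply/val_inj; rewrite /= mulrDr. Qed.
Fact corner_one_neq0 : corner_one != 0.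
Proof. by apply/eqP => /(congr1 val) /=; exact: (@idem_neq0 _ e). Qed.

HB.instance Definition _ := GRing.Zmodule_isNzRing.Build corner
  corner_mulA corner_mul1 corner_mulr1 corner_mulDl corner_mulDr
  corner_one_neq0.

End Corner.

Section PrincipalModule.
Variables (R : nzRingType) (e : nzidempotent R).

Definition Re_pred : {pred R} := [pred x | `[< exists r : R, x = r * (e : R) >]].

Record Re := InRe { Re_val :> R; _ : Re_val \in Re_pred }.

HB.instance Definition _ := [isSub for Re_val].
HB.instance Definition _ := [Choice of Re by <:].

Fact Re_zmod_closed : zmod_closed Re_pred.
Proof.
split=> [|_ _ /asboolP[r ->] /asboolP[s ->]]; apply/asboolP.
  by exists 0; rewrite mul0r.
by exists (r - s); rewrite mulrBl.
Qed.
HB.instance Definition _ :=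
  GRing.isZmodClosed.Build R Re_pred Re_zmod_closed.
HB.instance Definition _ := [SubChoice_isSubZmodule of Re by <:].

Fact Re_valP (x : Re) : exists r : R, (x : R) = r * (e : R).
Proof. by case: x => x /= /asboolP. Qed.

Fact Re_act_subproof (a : corner e) (x : Re) : (x : R) * (a : R) \in Re_pred.
Proof.
have [[r ->] [s ->]] := (corner_valP a, Re_valP x); apply/asboolP.
by exists (s * (e : R) * (e : R) * r); rewrite !mulrA.
Qed.
Definition Re_act (a : (corner e)^c) (x : Re) : Re :=
  InRe (Re_act_subproof a x).

Fact Re_actA (a b : (corner e)^c) (x : Re) :
  Re_act a (Re_act b x) = Re_act (a * b) x.
Proof. by apply/val_inj; rewrite /= mulrA. Qed.
Fact Re_act1 : left_id 1 Re_act.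
Proof.
move=> x; apply/val_inj; rewrite /=; have [r ->] := Re_valP x.
by rewrite -mulrA (idemP e).
Qed.
Fact Re_actDr : right_distributive Re_act +%R.
Proof. by move=> a x y; apply/val_inj; rewrite /= mulrDl. Qed.
Fact Re_actDl (x : Re) : {morph Re_act^~ x : a b / a + b}.
Proof. by move=> a b; apply/val_inj; rewrite /= mulrDr. Qed.

HB.instance Definition _ := GRing.Zmodule_isLmodule.Build (corner e)^c Re
  Re_actA Re_act1 Re_actDr Re_actDl.

End PrincipalModule.

(* Topological modules over R, where R has the discrete topology. The library's
   topologicalLmodType requires the scalars to form a numDomainType, and its
   join structures do not allow another join of TopologicalZmodule and Lmodule,
   so the action is given by explicit fields; topMod_lmod A is the underlying
   R-module. *)
Record topologicalModule (R : nzRingType) := TopologicalModule {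
  topMod_sort :> topologicalZmodType;
  topMod_scale : R -> topMod_sort -> topMod_sort;
  topMod_scaleA : forall a b x,
    topMod_scale a (topMod_scale b x) = topMod_scale (a * b) x;
  topMod_scale1 : left_id 1 topMod_scale;
  topMod_scaleDr : right_distributive topMod_scale +%R;
  topMod_scaleDl : forall x, {morph topMod_scale^~ x : a b / a + b};
  topMod_scale_continuous :
    continuous (fun z : discrete_topology R * topMod_sort =>
                  topMod_scale z.1 z.2) }.

Definition topMod_lmod (R : nzRingType) (A : topologicalModule R) : Type := A.

HB.instance Definition _ (R : nzRingType) (A : topologicalModule R) :=
  GRing.Zmodule.on (topMod_lmod A).
HB.instance Definition _ (R : nzRingType) (A : topologicalModule R) :=
  GRing.Zmodule_isLmodule.Build R (topMod_lmod A)
    (@topMod_scaleA R A) (@topMod_scale1 R A)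
    (@topMod_scaleDr R A) (@topMod_scaleDl R A).

Definition separable_space (T : topologicalType) : Prop :=
  exists2 D : set T, countable D & dense D.

Definition completely_metrizable (K : realType) (T : topologicalType) : Prop :=
  exists d : T -> T -> K,
    [/\ [/\ forall x y, d x y = 0 <-> x = y, forall x y, d x y = d y x &
            forall y x z, d x z <= d x y + d y z],
        forall x (A : set T), nbhs x A <->
          exists2 r : K, 0 < r & [set y | d x y < r] `<=` A &
        forall u : nat -> T,
          (forall eps : K, 0 < eps -> exists n0 : nat, forall m n,
             (n0 <= m)%N -> (n0 <= n)%N -> d (u m) (u n) < eps) ->
          exists l : T, u @ \oo --> l].

Definition polish (K : realType) (T : topologicalType) : Prop :=
  separable_space T /\ completely_metrizable K T.

(* Main.v *)
From HB Require Import structures.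
Require Import Defs.
From mathcomp Require Import all_boot all_order all_algebra.
From mathcomp Require Import boolp classical_sets functions cardinality reals.
From mathcomp Require Import topology normedtype.
From mathcomp Require Import ring lra.

(** The implications are proved in a cycle.

    From (1) to (2).  Let [A] be Polish, uncountable and projective.  A dual
    basis provides coordinates [c_b : A -> R], indexed by the points [b] of [A],
    with finite supports.  Call [u] in [R] big if it is a value of uncountably
    many coordinates; the big values generate a two-sided ideal [T]
    ([trace_ideal]).  Since [R] is countable and [A] separable, every
    uncountable family in [A] has two members whose difference is as small as
    wanted and has no component on the countably many indices with a value
    that is not big ([small_difference]).  Hence [T = TT <> 0], and summing
    convergent series of such differences gives more.

    - Chain condition ([chase], [trace_chain], [trace_ann]): in a decreasing
      sequence of principal right ideals [I_n], or of right annihilators [I_n]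
      of finite sets, some [I_n T] is contained in [I_(n+1)]; otherwise the sum
      of a suitable series would have infinitely many nonzero coordinates.
    - Coherence ([open_mapping], [trace_coherent]): for [v] in [R] the right
      ideal [{t in T | v t = 0}] is finitely generated up to right
      multiplication by [T].  Indeed [{a | v a = 0}] is closed in [A] and is
      covered by countably many cosets of the increasing subgroups
      [k_0 A + ... + k_(n-1) A], where the [k_j] enumerate that ideal; by the
      Baire category theorem and an open mapping argument, one of these
      subgroups is open.

    The rest is ring theory.  The chain condition produces idempotents of [T]
    ([chain_idempotent]), and an irreducible one has a local corner ring
    ([irreducible_local]).  Suppose that [Re] has infinite length over [eRe] for
    every irreducible [e] in [T].  A minimal [x] such that [xRe] has infinite
    length can be chosen in [Re'] with [e'] irreducible in [T], and coherence
    shows that [vRe' = 0] whenever [vRe] has finite length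
    ([next_idempotent]).  Iterating gives [e_0, e_1, ...]; if [y_n] generates a
    simple submodule of [R e_n] ([simple_cyclic_Re]), then [y_n R e_m = 0] for
    [n < m] while [y_n e_n <> 0], so the annihilators of [{y_0, ..., y_n}]
    decrease strictly, against the chain condition.

    From (2) to (3).  The corner [eRe] is a right submodule of [Re], and modules
    of finite length are artinian.

    From (3) to (4).  Now [S = eRe] is local, its radical [J] is nilpotent and
    finitely generated as a right ideal, and [Re], being noetherian over the
    right noetherian ring [S], is finitely presented.  A subset of [S^omega]
    maximal among those whose finite subsets have dual functionals is
    independent and generates modulo [J^omega]; since [J^omega = J S^omega] and
    [J] is nilpotent it is a basis ([split_basis]).

    From (4) to (1).  The module is [(Re)^omega], a countable power of a
    countable discrete set.  If [B] is a basis of [S^omega], finite presentation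
    of [Re] makes every element of [(Re)^omega] a unique combination
    [n |-> sum_b x_b b(n)] with [x_b] in [Re]: [(Re)^omega] is a direct sum of
    copies of [Re] ([expansion_exists], [expansion_unique]), hence
    projective. *)

Set Implicit Arguments.
Unset Strict Implicit.
Unset Printing Implicit Defensive.

Import GRing.Theory.

Local Open Scope classical_set_scope.
Local Open Scope ring_scope.

(** * Idempotents from a chain condition *)

(** One Newton step [h |-> 3 h^2 - 2 h^3] multiplies the defect [h - h^2] by
    itself, up to a polynomial in [h], and stays in [hR]; moreover it keeps the
    equation [x h = x], since [3 - 2 = 1].  The identities hold in [Z[X]] and
    are transported along evaluation at [h]. *)
Lemma lift_idempotent (R : nzRingType) (k : nat) (x h : R) :
  (h - h ^+ 2) ^+ (2 ^ k) = 0 -> x * h = x ->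
  exists g, (h * g) * (h * g) = h * g /\ x * (h * g) = x.
Proof.
elim: k h => [|k IHk] h.
  rewrite expn0 expr1 => /eqP; rewrite subr_eq0 => /eqP hh xh.
  by exists 1; rewrite mulr1; split=> //; rewrite [RHS]hh expr2.
move=> zk xh.
have hP : commr_rmorph (intr : int -> R) h by move=> m; exact: commr_int.
(* evaluation at h, through which commutative identities are imported *)
pose phi : {rmorphism {poly int} -> R} := horner_morph hP.
have phiX : phi 'X = h by exact: horner_morphX.
pose G : {poly int} := 'X * (3%:R - 2%:R * 'X).
have := IHk (h * phi G).
have -> : h * phi G - (h * phi G) ^+ 2 =
    phi (('X - 'X ^+ 2) ^+ 2 * ((3%:R - 2%:R * 'X) * (1 + 2%:R * 'X))).
  rewrite -{1 2}phiX -rmorphM -rmorphXn -rmorphB /G; congr (phi _); ring.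
rewrite -rmorphXn exprMn_comm; last exact: mulrC.
have zphi : phi (('X - 'X ^+ 2) ^+ (2 ^ k.+1)) = 0.
  by rewrite rmorphXn rmorphB [phi ('X ^+ 2)]rmorphXn phiX.
rewrite -exprM -expnS rmorphM zphi mul0r.
have -> : x * (h * phi G) = x.
  rewrite /G rmorphM rmorphB rmorphM !rmorph_nat phiX mulrA xh mulrA xh.
  rewrite mulrBr !mulr_natr !mulr_natl mulrnAr xh.
  by rewrite -mulrnBr.
move=> /(_ (erefl 0) (erefl x)) [g [gg xg]].
by exists (phi G * g); rewrite !mulrA in gg xg *.
Qed.

(** In this section [T] is an idempotent two-sided ideal such that any decreasing
    sequence of right ideals [x_n R] satisfies [x_n T <= x_(n+1) R] for some [n].
    This is weaker than the descending chain condition on principal right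
    ideals, and is all that the topology provides. *)
Section ChainAlgebra.
Variables (R : nzRingType) (T : R -> Prop).
Hypotheses (T0 : T 0) (TD : forall x y, T x -> T y -> T (x + y))
  (TMl : forall r x, T x -> T (r * x)) (TMr : forall x r, T x -> T (x * r)).
Hypothesis (T_idem : forall t, T t -> exists s : seq (R * R),
  (forall p, p \in s -> T p.1 /\ T p.2) /\ t = \sum_(p <- s) p.1 * p.2).
Hypothesis (T_chain : forall x : nat -> R,
  (forall n, exists r, x n.+1 = x n * r) ->
  exists n, forall t, T t -> exists r, x n * t = x n.+1 * r).

(** Because [T = TT], an inclusion [xT <= yR] improves to [xT <= yT]. *)
Lemma ideal_absorb x y : (forall t, T t -> exists r, x * t = y * r) ->
  forall t, T t -> exists2 r, T r & x * t = y * r.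
Proof.
move=> xy t /T_idem[s [sT ->]].
rewrite mulr_sumr big_seq; elim/big_rec: _ => [|p z /sT[T1 T2] [r Tr ->]].
  by exists 0; rewrite ?mulr0.
have [r1 e1] := xy _ T1; exists (r1 * p.2 + r).
  by apply: TD => //; exact: TMl.
by rewrite mulrA e1 -mulrA mulrDr.
Qed.

(** A sequence of counterexamples [x, x r, x r r', ...] to minimality would
    contradict the chain condition. *)
Lemma chain_min (P : R -> Prop) x0 : P x0 ->
  exists2 x, P x & (exists r, x = x0 * r) /\
    (forall r, P (x * r) -> forall t, T t -> exists r', x * t = x * r * r').
Proof.
move=> Px0; apply: contrapT => noMin.
have next (x : R) : exists r, P x -> (exists r, x = x0 * r) ->
    P (x * r) /\ ~ (forall t, T t -> exists r', x * t = x * r * r').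
  have [[Px xx0]|nP] := pselect (P x /\ exists r, x = x0 * r); last first.
    by exists 0 => Px xx0; case: nP.
  apply: contrapT => noR; apply: noMin; exists x => //; split=> // r Pxr t Tt.
  apply: contrapT => nt; apply: noR; exists r => _ _; split=> //.
  by move=> /(_ t Tt).
have [f fP] := choice next.
pose u n := iter n (fun x => x * f x) x0.
have uP n : P (u n) /\ exists r, u n = x0 * r.
  elim: n => [|n [Pu [r ur]]]; first by split=> //; exists 1; rewrite mulr1.
  split; first by have [] := fP _ Pu (ex_intro _ r ur).
  by exists (r * f (u n)); rewrite mulrA -ur.
have [|n nP] := @T_chain u; first by move=> n; exists (f (u n)).
by have [Pu xu] := uP n; have [_ []] := fP _ Pu xu.
Qed.

(** If [P] can always be kept by a multiplication by some [t] in [T], replacing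
    the minimal [x] by [x t] turns [xT <= x r R] into [x] belonging to
    [x r R], and puts [x] in [xT]. *)
Lemma chain_min_absorb (P : R -> Prop) x0 :
  (forall x, P x -> exists2 t, T t & P (x * t)) -> P x0 ->
  exists2 x, P x & [/\ exists2 t, T t & x = x0 * t, exists2 t, T t & x = x * t &
    forall r, P (x * r) -> exists r', x = x * r * r'].
Proof.
move=> PT /chain_min[x Px [[r0 xx0] xmin]].
have [t Tt Pxt] := PT _ Px.
have xtmin r : P (x * t * r) -> exists r', x * t = x * t * r * r'.
  by rewrite -[x * t * r]mulrA => /xmin /(_ t Tt).
exists (x * t) => //; split.
- by exists (r0 * t); [exact: TMl | rewrite xx0 mulrA].
- have [t' Tt' Pxtt'] := PT _ Pxt.
  have [r' e] := xtmin _ Pxtt'.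
  by exists (t' * r'); [exact: TMr | rewrite mulrA].
- exact: xtmin.
Qed.

(** This replaces the classical fact that a right ideal of a right artinian
    ring which is not nilpotent contains an idempotent.  Choose [h1] in [hR]
    minimal with [x h1 = x].  Every [h1 - z k], where [z = h1 - h1^2], still
    fixes [x] and so generates as much as [h1]; this forces [z] to be nilpotent,
    and [h1] can be lifted to an idempotent. *)
Lemma chain_idempotent x h : T h -> x * h = x ->
  exists g, (h * g) * (h * g) = h * g /\ x * (h * g) = x.
Proof.
move=> Th xh.
have [h' xh1 [[r0 h'E] hmin]] := @chain_min (fun h' => x * h' = x) h xh.
rewrite {h'}h'E in xh1 hmin.
suff [g] : exists g, (h * r0 * g) * (h * r0 * g) = h * r0 * g /\
    x * (h * r0 * g) = x.
  by rewrite -[h * r0 * g]mulrA => gP; exists (r0 * g).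
set h1 := h * r0 in xh1 hmin *.
have Th1 : T h1 by exact: TMr.
clearbody h1.
have [z zE] : exists z, z = h1 * (1 - h1) by exists (h1 * (1 - h1)).
have Tz : T z by rewrite zE; exact: TMr.
have xz : x * z = 0 by rewrite zE mulrA xh1 mulrBr mulr1 xh1 subrr.
(* h1 - z k = h1 (1 - (1 - h1) k) fixes x, since x z = 0 *)
have zmin k t : T t -> exists r, h1 * t = (h1 - z * k) * r.
  have kE : h1 * (1 - (1 - h1) * k) = h1 - z * k.
    by rewrite mulrBr mulr1 mulrA -zE.
  move=> Tt; rewrite -kE; apply: hmin => //.
  by rewrite kE mulrBr xh1 mulrA xz mul0r subr0.
have [n nz] := @T_chain (fun n => z ^+ n) (fun n => ex_intro _ z (exprSr z n)).
(* z^(n+1) = z^n z lies in z^n T, hence in z^(n+2) R *)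
have [k zk] : exists k, z ^+ n.+1 = z ^+ n.+1 * (z * k).
  have [r Tr e1] := ideal_absorb nz Tz.
  have [r' e2] := nz _ Tr.
  exists r'; rewrite {1}exprSr e1 [X in X * r]exprS -mulrA e2.
  by rewrite !mulrA -exprS -exprSr.
have zh t : T t -> z ^+ n.+1 * (h1 * t) = 0.
  move=> Tt; have [r ->] := zmin (k * h1) t Tt.
  have zkh : z ^+ n.+1 * (h1 - z * (k * h1)) = 0.
    by rewrite mulrBr [z * _]mulrA [z ^+ _ * (_ * h1)]mulrA -zk subrr.
  by rewrite mulrA zkh mul0r.
have z0 : z ^+ (2 ^ n.+3) = 0.
  have le3 : (n.+3 <= 2 ^ n.+3)%N by exact/ltnW/ltn_expl.
  suff z3 : z ^+ n.+3 = 0 by rewrite -(subnK le3) exprD z3 mulr0.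
  by rewrite 2!exprSr {2}zE -!mulrA zh //; exact: TMl.
by apply: lift_idempotent xh1; rewrite -z0 zE mulrBr mulr1 expr2.
Qed.

(** The minimal element for a property that splits over sums can be taken of the
    form [x e] with [e] irreducible: an idempotent [f] with [x f = x] exists, and
    when a minimal one splits, one of the two halves still has the property.
    When [P 0] fails, [e] cannot be zero; hence the disjunction. *)
Lemma chain_min_irreducible (P : R -> Prop) x0 :
  (forall x, P x -> exists2 t, T t & P (x * t)) ->
  (forall x y, P (x + y) -> P x \/ P y) -> P x0 ->
  exists e x, [/\ T e, irreducible_idempotent e \/ P 0, x * e = x, P x &
    forall r, P (x * r) -> exists r', x = x * r * r'].
Proof.
move=> PT PD /(chain_min_absorb PT) [x Px [_ [h Th /esym xh] xmin]].
have [g0 [f0f0 xf0]] := chain_idempotent Th xh.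
pose Q f := T f /\ exists2 e, e * e = e & f = e /\ P (x * e).
have Qf0 : Q (h * g0).
  by split; [exact: TMr | exists (h * g0); rewrite ?xf0].
have [f [Tf [f' ff [ff' Pxf]]] [_ fmin]] := chain_min Qf0.
rewrite -{f'}ff' in ff Pxf.
exists f, (x * f); split=> //.
- have [P0|nP0] := pselect (P 0); [by right | left].
  split=> //; first by move=> f0; move: Pxf; rewrite f0 mulr0.
  have half f1 f2 : f1 * f1 = f1 -> f1 * f2 = 0 -> f2 * f1 = 0 ->
      f = f1 + f2 -> P (x * f1) -> f2 = 0.
    move=> f11 f12 f21 fE Pxf1.
    have ff1 : f * f1 = f1 by rewrite fE mulrDl f11 f21 addr0.
    have f1f : f1 * f = f1 by rewrite fE mulrDr f11 f12 addr0.
    have [|r fr] := fmin f1 _ f Tf.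
      rewrite ff1; split; first by rewrite -ff1; exact: TMr.
      by exists f1.
    have f1E : f1 = f by rewrite -[LHS]f1f -ff fr ff1 mulrA f11.
    by apply: (addrI f1); rewrite addr0 -fE f1E.
  case=> f1 [f2 [[f11 f22 f12 f21] nf1 nf2 fE]].
  move: Pxf; rewrite fE mulrDr => /PD[Pxf1|Pxf2].
    by apply: nf2; apply: (half f1).
  by apply: nf1; apply: (half f2) => //; rewrite addrC.
- by rewrite -mulrA ff.
- move=> r Pr.
  have [|r' e] := xmin (f * r); first by rewrite mulrA.
  by exists (r' * f); rewrite {1}e !mulrA.
Qed.
End ChainAlgebra.

(** * Length over a local corner ring *)

(** For the corner ring this amounts to being local with a nil radical. *)
Definition nil_or_unit (R : nzRingType) (e : R) : Prop :=
  forall s, e * s * e = s -> (exists n, s ^+ n.+1 = 0) \/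
    exists s', [/\ e * s' * e = s', s * s' = e & s' * s = e].

Section Length.
Variables (R : nzRingType) (e : R).
Hypotheses (ee : e * e = e) (e_local : nil_or_unit e).

(** The subsets of [Re] that are reached from [0] by finitely many steps, each
    adding one generator whose multiples by the radical are already there.  Over
    a local corner ring these are the right submodules of finite length.  This
    form, where steps may be trivial, makes sums and quotients easy to handle. *)
Inductive filtered : set R -> Prop :=
| filtered_zero : filtered [set 0]
| filtered_step (N : set R) x : filtered N -> x * e = x ->
    (forall s n, e * s * e = s -> s ^+ n.+1 = 0 -> N (x * s)) ->
    filtered [set y | exists n s, [/\ N n, e * s * e = s & y = n + x * s]].

Lemma corner_sub s t : e * s * e = s -> e * t * e = t -> e * (s - t) * e = s - t.
Proof. by move=> hs ht; rewrite mulrBr mulrBl hs ht. Qed.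
Lemma corner_e s : e * s * e = s -> e * s = s /\ s * e = s.
Proof. by move=> hs; rewrite -hs; rewrite !mulrA ee -!mulrA ee. Qed.
Lemma corner_M s t : e * s * e = s -> e * t * e = t -> e * (s * t) * e = s * t.
Proof. by move=> /corner_e[hs _] /corner_e[_ ht]; rewrite mulrA hs -mulrA ht. Qed.
Lemma corner_0 : e * 0 * e = 0. Proof. by rewrite mulr0 mul0r. Qed.
Lemma corner_1 : e * e * e = e. Proof. by rewrite !ee. Qed.
Definition corner_submodule (N : set R) : Prop := [/\ N 0, forall x y, N x -> N y -> N (x - y),
  forall x s, e * s * e = s -> N x -> N (x * s) & forall x, N x -> x * e = x].

Lemma corner_submoduleD N x y : corner_submodule N -> N x -> N y -> N (x + y).
Proof.
case=> N0 NB _ _ Nx Ny; have -> : x + y = x - (0 - y) by rewrite sub0r opprK.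
by apply: (NB) => //; exact: NB.
Qed.

Lemma filtered_submodule N : filtered N -> corner_submodule N.
Proof.
elim=> [|{}N x fN [N0 NB NM Ne] xe xJ].
  split=> //= [x y -> ->|x s _ ->|x ->]; by rewrite ?subrr ?mul0r.
split=> /=.
- by exists 0, 0; rewrite corner_0 mulr0 addr0.
- move=> y z [n [s [Nn hs ->]]] [m [t [Nm ht ->]]].
  exists (n - m), (s - t); split; [exact: NB|exact: corner_sub|].
  by rewrite mulrBr opprD addrACA.
- move=> y t ht [n [s [Nn hs ->]]].
  exists (n * t), (s * t); split; [exact: NM|exact: corner_M|].
  by rewrite mulrDl mulrA.
- move=> y [n [s [Nn hs ->]]].
  by rewrite mulrDl (Ne _ Nn) -mulrA (corner_e hs).2.
Qed.

Lemma filtered_eq N N' : filtered N -> (forall x, N x <-> N' x) -> filtered N'.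
Proof. by move=> fN NN'; have <- : N = N' by apply/seteqP; split=> x /NN'. Qed.

Lemma filtered_add N N' : filtered N -> filtered N' -> filtered [set y | exists n n', [/\ N n, N' n' & y = n + n']].
Proof.
move=> fN; have [N0 _ _ _] := filtered_submodule fN; elim=> [|{}N' x fN' IH xe xJ].
  apply: (filtered_eq fN) => y; split=> [Ny|[n [_ [Nn -> ->]]]]; last by rewrite addr0.
  by exists y, 0; rewrite addr0.
apply: (filtered_eq (@filtered_step _ x IH xe _)) => [s n hs sn|y].
  by exists 0, (x * s); rewrite add0r; split=> //; exact: xJ hs sn.
split.
  move=> [_ [s [[n [n' [Nn Nn' ->]]] hs ->]]].
  exists n, (n' + x * s); split=> //; first by exists n', s.
  by rewrite addrA.
move=> [n [_ [Nn [n' [s [Nn' hs ->]]] ->]]].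
exists (n + n'), s; split=> //; last by rewrite addrA.
by exists n, n'.
Qed.

(** At a step [N + xS] with [N'] not inside [N], some [z] in [N'] has the form
    [n + x s] with [s] a unit, and then [N'] is generated by [z] over its
    intersection with [N]. *)
Lemma filtered_sub N N' : filtered N -> corner_submodule N' -> (forall x, N' x -> N x) -> filtered N'.
Proof.
move=> fN; elim: fN N' => [|{}N x fN IH xe xJ] N' sN' N'N.
  have [N'0 _ _ _] := sN'.
  by apply: (filtered_eq filtered_zero) => y; split=> [->|/N'N].
have [N'0 N'B N'M N'e] := sN'; have [N0 NB NM Ne] := filtered_submodule fN.
have fN'N : filtered (N' `&` N).
  apply: IH => [|y []//]; split=> //.
  - by move=> y z [? ?] [? ?]; split; [exact: N'B | exact: NB].
  - by move=> y s hs [? ?]; split; [exact: N'M | exact: NM].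
  - by move=> y [? ?]; exact: N'e.
have [sub|] := pselect (forall y, N' y -> N y).
  by apply: (filtered_eq fN'N) => y; split=> [[]//|N'y]; split=> //; exact: sub.
move=> /existsNP[z /not_implyP[N'z nNz]].
have [n [s [Nn hs zE]]] := N'N _ N'z.
have [[k sk]|[s' [hs' ss' s's]]] := e_local hs.
  by case: nNz; rewrite zE; apply: corner_submoduleD (filtered_submodule fN) Nn (xJ _ _ hs sk).
have zs' : z * s' = n * s' + x by rewrite zE mulrDl -mulrA ss' xe.
apply: (filtered_eq (@filtered_step _ (z * s') fN'N _ _)) => [|t k ht tk|y].
- by rewrite -mulrA (corner_e hs').2.
- split; first by apply: (N'M) => //; exact: N'M.
  rewrite zs' mulrDl; apply: corner_submoduleD (filtered_submodule fN) _ (xJ _ _ ht tk).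
  by apply: (NM) => //; exact: NM.
split.
  move=> [m [t [[N'm Nm] ht ->]]]; apply: corner_submoduleD sN' N'm _.
  by apply: (N'M) => //; exact: N'M.
move=> N'y; have [m [t [Nm ht yE]]] := N'N _ N'y.
exists (y - z * s' * t), t; split=> //; last by rewrite subrK.
split; first by apply: (N'B) => //; apply: (N'M) => //; exact: N'M.
rewrite zs' yE mulrDl opprD addrACA subrr addr0; apply: NB => //.
by apply: (NM) => //; exact: NM.
Qed.

(** The right [eRe]-submodule [vRe]. *)
Definition cyclic_Re (v : R) : set R := [set y | exists r, y = v * r * e].

Lemma cyclic_Re_submodule v : corner_submodule (cyclic_Re v).
Proof.
split=> [|_ _ [r ->] [r' ->]|_ s hs [r ->]|_ [r ->]].
- by exists 0; rewrite mulr0 mul0r.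
- by exists (r - r'); rewrite mulrBr mulrBl.
- by exists (r * e * s); rewrite -!mulrA (corner_e hs).2.
- by rewrite -mulrA ee.
Qed.

Lemma filtered_cyclic0 : filtered (cyclic_Re 0).
Proof.
apply: (filtered_eq filtered_zero) => y; split=> [->|[r ->]]; last by rewrite !mul0r.
by exists 0; rewrite !mul0r.
Qed.

(** The map [v r |-> x r] is well defined modulo [G], so it carries a filtration
    of [N] to a filtration above [G]. *)
Lemma filtered_transport v x G N : filtered G -> filtered N -> (forall y, N y -> cyclic_Re v y) ->
  (forall r, r * e = r -> v * r = 0 -> G (x * r)) ->
  filtered [set y | exists r g, [/\ r * e = r, N (v * r), G g & y = x * r + g]].
Proof.
move=> fG; have sG := filtered_submodule fG; have [G0 GB GM Ge] := sG.
move=> + + vxG; elim=> [_|{}N w fN IH we wJ NV].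
  apply: (filtered_eq fG) => y; split=> [Gy|[r [g [re vr Gg ->]]]].
    by exists 0, y; rewrite mul0r !mulr0 add0r.
  by apply: corner_submoduleD sG _ Gg; exact: vxG.
have sN := filtered_submodule fN; have [N0 NB NM Ne] := sN.
have NN y : N y -> cyclic_Re v y.
  by move=> Ny; apply: NV; exists y, 0; rewrite corner_0 mulr0 addr0.
have [r0 wE] : cyclic_Re v w.
  by apply: NV; exists 0, e; rewrite corner_1 add0r we.
apply: (filtered_eq (@filtered_step _ (x * (r0 * e)) (IH NN) _ _)) => [|s k hs sk|y].
- by rewrite -!mulrA ee.
- exists (r0 * e * s), 0; split=> //; last by rewrite addr0 !mulrA.
    by rewrite -mulrA (corner_e hs).2.
  by rewrite !mulrA -wE; exact: wJ hs sk.
split.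
  move=> [_ [s [[r [g [re Nvr Gg ->]]] hs ->]]].
  exists (r + r0 * e * s), g; split=> //; last by rewrite mulrDr addrAC !mulrA.
    by rewrite mulrDl re -mulrA (corner_e hs).2.
  by exists (v * r), s; split=> //; rewrite mulrDr wE !mulrA.
move=> [r [g [re [n [s [Nn hs vrE]]] Gg ->]]].
exists (x * (r - r0 * e * s) + g), s; split=> //.
  exists (r - r0 * e * s), g; split=> //.
    by rewrite mulrBl re -!mulrA (corner_e hs).2.
  by rewrite mulrBr vrE wE !mulrA addrK.
by rewrite mulrBr !mulrA addrAC subrK.
Qed.

Lemma filtered_cyclic_sum n (k : nat -> R) x : (forall j, (j < n)%N -> filtered (cyclic_Re (x * k j))) ->
  exists2 G, filtered G & forall r : nat -> R, G (\sum_(j < n) x * k j * r j * e).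
Proof.
elim: n => [_|n IH kn].
  by exists [set 0]; [exact: filtered_zero | move=> r; rewrite big_ord0].
have [|G fG GP] := IH; first by move=> j jn; apply: kn; exact: ltnW.
exists [set y | exists n1 n', [/\ G n1, cyclic_Re (x * k n) n' & y = n1 + n']].
  exact: filtered_add fG (kn n _).
move=> r; rewrite big_ord_recr /=; eexists _, _; split; last by [].
  exact: GP.
by exists (r n).
Qed.

End Length.

(** * An irreducible idempotent of finite length *)

(** The hypotheses on [T] are those established for the ideal of big coordinate
    values of an uncountable Polish projective module. *)
Section IdempotentAlgebra.
Variables (R : nzRingType) (T : R -> Prop).
Hypotheses (T0 : T 0) (TD : forall x y, T x -> T y -> T (x + y))
  (TMl : forall r x, T x -> T (r * x)) (TMr : forall x r, T x -> T (x * r)).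
Hypothesis (T_idem : forall t, T t -> exists s : seq (R * R),
  (forall p, p \in s -> T p.1 /\ T p.2) /\ t = \sum_(p <- s) p.1 * p.2).
Hypothesis (T_chain : forall x : nat -> R,
  (forall n, exists r, x n.+1 = x n * r) ->
  exists n, forall t, T t -> exists r, x n * t = x n.+1 * r).
Hypothesis (T_ann : forall y : nat -> R, exists n,
  forall z u, (forall k, (k < n)%N -> y k * z = 0) -> T u -> y n * (z * u) = 0).
Hypothesis (T_coh : forall v, exists n (k : nat -> R),
  (forall j, T (k j) /\ v * k j = 0) /\
  forall t u, T t -> v * t = 0 -> T u ->
    exists r : nat -> R, t * u = \sum_(j < n) k j * r j).
Hypothesis (T_neq0 : exists2 t, T t & t <> 0).

Lemma nil_right_inv (e s w : R) n : s * e = s -> s ^+ n.+1 = 0 -> s * w = e -> e = 0.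
Proof.
move=> se + sw; elim: n => [|n IH] sn; first by rewrite -sw -[s]expr1 sn mul0r.
apply: IH; have -> : s ^+ n.+1 = s ^+ n.+2 * w.
  by rewrite [in RHS]exprSr -mulrA sw exprSr -mulrA se.
by rewrite sn mul0r.
Qed.

(** For [s] in [eRe] the chain [s^n R] gives [x = s^n e] with [x] in [x sT], hence
    an idempotent [f] in [sR] fixing [x].  If [x <> 0], then [fe] is a nonzero
    idempotent below [e], so [fe = e] and [s] has a right inverse. *)
Lemma irreducible_local e : T e -> irreducible_idempotent e -> nil_or_unit e.
Proof.
move=> Te [ee e0 eirr].
have right_inv s : e * s * e = s -> (exists n, s ^+ n.+1 = 0) \/
    exists s', e * s' * e = s' /\ s * s' = e.
  move=> hs; have [es se] := corner_e ee hs.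
  have [n nP] := @T_chain (fun n => s ^+ n) (fun n => ex_intro _ s (exprSr s n)).
  have [r Tr snr] := ideal_absorb T0 TD TMl T_idem nP Te.
  have xh : s ^+ n * e * (s * r) = s ^+ n * e.
    by rewrite -mulrA [e * _]mulrA es mulrA -exprSr -snr.
  have [x0|xn0] := eqVneq (s ^+ n * e) 0.
    by left; exists n; rewrite exprSr -[X in _ * X]es mulrA x0 mul0r.
  right; have [g [ff xf]] := chain_idempotent T0 TD TMl TMr T_idem T_chain
    (TMl s Tr) xh.
  set f := s * r * g in ff xf.
  have ef : e * f = f by rewrite /f !mulrA es.
  have fefe : (f * e) * (f * e) = f * e by rewrite mulrA -[f * e * f]mulrA ef ff.
  have fe0 : f * e <> 0.
    move=> fe0; move/eqP: xn0; apply.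
    have -> : s ^+ n * e = s ^+ n * e * (f * e) by rewrite mulrA xf -mulrA ee.
    by rewrite fe0 mulr0.
  have efe : e * (f * e) = f * e by rewrite mulrA ef.
  have fee : f * e * e = f * e by rewrite -mulrA ee.
  have feE : e - f * e = 0.
    apply: contrapT => nz; apply: eirr; exists (f * e), (e - f * e).
    split=> //; last by rewrite addrC subrK.
    split=> //; rewrite /is_idempotent ?mulrBl ?mulrBr ?ee ?fefe ?efe ?fee;
      by rewrite ?subrr ?subr0.
  exists (e * (r * g * e) * e); split; first by rewrite !mulrA ee -!mulrA !ee.
  have eE : e = f * e by apply/eqP; rewrite -subr_eq0 feE.
  by rewrite [RHS]eE !mulrA se -!mulrA !ee /f !mulrA.
move=> s hs; have [|[s' [hs' ss']]] := right_inv s hs; first by left.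
right; exists s'; split=> //.
have [es' s'e] := corner_e ee hs'; have [es se] := corner_e ee hs.
have [[n s'n]|[s'' [hs'' s's'']]] := right_inv s' hs'.
  have s'0 m : s' ^+ m.+1 = 0 -> s' = 0.
    elim: m => [|m IH] h; first by rewrite -h expr1.
    apply: IH; have -> : s' ^+ m.+1 = s * s' ^+ m.+2.
      by rewrite [in RHS]exprS mulrA ss' exprS mulrA es'.
    by rewrite h mulr0.
  by case: e0; rewrite -ss' (s'0 n) // mulr0.
have <- : s'' = s by rewrite -[RHS]se -s's'' mulrA ss' (corner_e ee hs'').1.
exact: s's''.
Qed.

(** A minimal [yRe <> 0] is a simple right [eRe]-module. *)
Lemma simple_cyclic_Re e : T e -> irreducible_idempotent e ->
  exists y, [/\ y <> 0, y * e = y & filtered e (cyclic_Re e y)].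
Proof.
move=> Te eirr; have [ee e0 _] := eirr.
have eloc := irreducible_local Te eirr.
pose P x := exists r, x * r * e <> 0.
have PT x : P x -> exists2 t, T t & P (x * t).
  move=> [r nz]; exists (r * e); first exact: TMl.
  by exists 1; rewrite mulr1 mulrA -mulrA ee.
have Pe : P e by exists 1; rewrite mulr1 ee.
have [y0 [r0 nz] [_ _ ymin]] := chain_min_absorb TMl TMr T_chain PT Pe.
set y := y0 * r0 * e in nz.
have yE : y * e = y by rewrite /y -mulrA ee.
exists y; split=> //.
have yJ s k : e * s * e = s -> s ^+ k.+1 = 0 -> y * s = 0.
  move=> hs sk; have [es se] := corner_e ee hs.
  apply: contrapT => ys.
  have [|r y0E] := ymin (r0 * e * s).
    by exists 1; rewrite mulr1 !mulrA -/y -mulrA se.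
  (* y q = y, so q is a unit, and then s has a right inverse *)
  pose q := s * (r * r0 * e).
  have hq : e * q * e = q by rewrite /q !mulrA es -mulrA ee.
  have y0E' : y * s * r = y0 by rewrite [RHS]y0E /y !mulrA.
  have yq : y * q = y by rewrite /q !mulrA y0E'.
  have [[m qm]|[s' [_ qs' _]]] := eloc q hq.
    have yqm j : y * q ^+ j = y.
      by elim: j => [|j IH]; rewrite ?mulr1 // exprS mulrA yq.
    by apply: nz; rewrite -(yqm m.+1) qm mulr0.
  apply: e0; apply: (nil_right_inv se sk (w := r * r0 * e * s')).
  by rewrite mulrA.
apply: (filtered_eq (@filtered_step _ _ _ _ (filtered_zero e) yE _)) => [s k hs sk|z] /=.
  exact: yJ hs sk.
split.
  move=> [_ [s [-> hs ->]]]; exists s.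
  by rewrite add0r -mulrA (corner_e ee hs).2.
move=> [r ->]; exists 0, (e * r * e); rewrite add0r !mulrA yE ee -!mulrA ee.
by split.
Qed.

(** Take [x = x e'] minimal with [xRe] of infinite length.  If [v' = v r e'] were a
    nonzero element with [v'Re] of finite length, let [K] be the annihilator of
    [v'] in [T].  By coherence [K] has finitely many generators [k_j] up to [T].
    Each [x k_j Re] has finite length: otherwise minimality gives [x = x q] with
    [q] in [e'Re'] and [v' q = 0], where [q] is nilpotent (so [x = 0]) or a unit
    (so [v' = 0]).  As [v' r |-> x r] is well defined modulo [xKe], also
    [xRe] has finite length, a contradiction. *)
Lemma next_idempotent e : T e -> irreducible_idempotent e -> ~ filtered e (cyclic_Re e 1) ->
  exists e', [/\ T e', irreducible_idempotent e' &
    forall v, filtered e (cyclic_Re e v) -> forall r, v * r * e' = 0].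
Proof.
move=> Te eirr nfl; have [ee e0 _] := eirr.
have eloc := irreducible_local Te eirr.
pose P x := ~ filtered e (cyclic_Re e x).
have nP0 : ~ P 0 by move=> h; apply: h; exact: filtered_cyclic0.
have PT x : P x -> exists2 t, T t & P (x * t).
  move=> Px; have [n [k [kT kP]]] := T_coh 0.
  apply: contrapT => noT; apply: Px.
  have [j jn|G fG GP] := @filtered_cyclic_sum _ e ee n k x.
    apply: contrapT => nj; apply: noT; exists (k j) => //; exact: (kT j).1.
  apply: (filtered_sub ee eloc fG (cyclic_Re_submodule ee x)) => _ [r ->].
  have [||//|s sE] := kP (r * e) e; [exact: TMl | by rewrite mul0r |].
  have -> : x * r * e = \sum_(j < n) x * k j * s j * e.
    rewrite -mulr_suml; under eq_bigr do rewrite -mulrA.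
    by rewrite -mulr_sumr -sE !mulrA -!mulrA !ee.
  exact: GP.
have PD x y : P (x + y) -> P x \/ P y.
  move=> Pxy; apply: contrapT => /not_orP[/contrapT fx /contrapT fy].
  apply: Pxy; apply: (filtered_sub ee eloc (filtered_add ee fx fy) (cyclic_Re_submodule ee _)).
  move=> _ [r ->]; exists (x * r * e), (y * r * e).
  by split; [exists r|exists r|rewrite !mulrDl].
have [e' [x [Te' e'irr xe' Px xmin]]] :=
  chain_min_irreducible T0 TD TMl TMr T_idem T_chain PT PD nfl.
have {}e'irr : irreducible_idempotent e' by case: e'irr.
have e'loc := irreducible_local Te' e'irr; have [e'e' _ _] := e'irr.
exists e'; split=> // v fv r0; apply: contrapT.
set v' := v * r0 * e' => v'0; apply: (Px).
have v'e' : v' * e' = v' by rewrite /v' -mulrA e'e'.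
have fv' : filtered e (cyclic_Re e v').
  apply: (filtered_sub ee eloc fv (cyclic_Re_submodule ee _)) => _ [r ->].
  by exists (r0 * e' * r); rewrite !mulrA.
have [n [k [kT kP]]] := T_coh v'.
have [j jn|G fG GP] := @filtered_cyclic_sum _ e ee n k x.
  apply: contrapT => /xmin[r xE].
  pose q := e' * (k j * r) * e'.
  have hq : e' * q * e' = q by rewrite /q !mulrA e'e' -!mulrA e'e'.
  have xq : x * q = x by rewrite /q !mulrA xe' -xE.
  have v'q : v' * q = 0 by rewrite /q !mulrA v'e' (kT j).2 !mul0r.
  have [[m qm]|[s' [_ qs' _]]] := e'loc q hq.
    have xqm i : x * q ^+ i = x.
      by elim: i => [|i IH]; rewrite ?mulr1 // exprS mulrA xq.
    by move: Px; rewrite -(xqm m.+1) qm mulr0.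
  by apply: v'0; rewrite -v'e' -qs' mulrA v'q mul0r.
have [G0 _ _ _] := filtered_submodule ee fG.
have fX := @filtered_transport _ _ ee v' x G (cyclic_Re e v') fG fv' (fun y h => h).
apply: (filtered_sub ee eloc (fX _) (cyclic_Re_submodule ee x)) => [r re vr|_ [r ->]].
  have Tr : T r by rewrite -re; exact: TMl.
  have [s sE] := kP r e Tr vr Te.
  have -> : x * r = \sum_(j < n) x * k j * s j * e.
    rewrite -mulr_suml; under eq_bigr do rewrite -mulrA.
    by rewrite -mulr_sumr -sE -!mulrA ee re.
  exact: GP.
exists (r * e), 0; split=> //; rewrite ?addr0 ?mulrA //.
  by rewrite -mulrA ee.
by exists r.
Qed.

(** Otherwise [next_idempotent] can be iterated forever, and the generators
    [y_n] of simple submodules of [R e_n] violate [T_ann]. *)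
Theorem finite_length_idempotent :
  exists e : R, [/\ irreducible_idempotent e, nil_or_unit e & filtered e (cyclic_Re e 1)].
Proof.
apply: contrapT => none.
have nfl e : T e -> irreducible_idempotent e -> ~ filtered e (cyclic_Re e 1).
  by move=> Te ei fe; apply: none; exists e; split=> //; exact: irreducible_local.
have [e0 [Te0 e0i]] : exists e, T e /\ irreducible_idempotent e.
  pose P x := exists2 t, T t & x * t <> 0.
  have nP0 : ~ P 0 by case=> t _; rewrite mul0r.
  have PT x : P x -> exists2 t, T t & P (x * t).
    move=> [t Tt xt]; have [s [sT tE]] := T_idem Tt.
    apply: contrapT => noT; apply: xt; rewrite tE mulr_sumr big_seq big1 // => p.
    move=> /sT[T1 T2]; apply: contrapT => nz; apply: noT; exists p.1 => //.
    by exists p.2 => //; rewrite -mulrA.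
  have PD x y : P (x + y) -> P x \/ P y.
    move=> [t Tt]; have [xt0|/eqP xt _] := eqVneq (x * t) 0.
      by rewrite mulrDl xt0 add0r => yt; right; exists t.
    by left; exists t.
  have [t0 Tt0 t0n] := T_neq0.
  have P1 : P 1 by exists t0 => //; rewrite mul1r.
  have [e [x [Te ei _ _ _]]] :=
    chain_min_irreducible T0 TD TMl TMr T_idem T_chain PT PD P1.
  by exists e; split=> //; case: ei.
have step (e : R) : exists e', T e -> irreducible_idempotent e ->
    [/\ T e', irreducible_idempotent e' &
    forall v, filtered e (cyclic_Re e v) -> forall r, v * r * e' = 0].
  have [[Te ei]|nT] := pselect (T e /\ irreducible_idempotent e).
    by have [e' e'P] := next_idempotent Te ei (nfl _ Te ei); exists e'.
  by exists 0 => Te ei; case: nT.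
have [f fP] := choice step.
pose u n := iter n f e0.
have uP n : T (u n) /\ irreducible_idempotent (u n).
  by elim: n => [|n [Tu ui]] //=; have [] := fP _ Tu ui.
have yex n : exists y, [/\ y <> 0, y * u n = y & filtered (u n) (cyclic_Re (u n) y)].
  by have [Tu ui] := uP n; exact: simple_cyclic_Re.
have [y yP] := choice yex.
have y_ann n d : forall r, y n * r * u (n + d.+1)%N = 0.
  elim: d => [|d IH]; rewrite addnS /=.
    rewrite addn0; have [Tu ui] := uP n.
    by have [_ _ h] := fP _ Tu ui; apply: h; have [] := yP n.
  have [Tu ui] := uP (n + d.+1)%N; have [uu _ _] := ui.
  have [_ _ h] := fP _ Tu ui; apply: h.
  apply: (filtered_eq (filtered_zero _)) => z; split=> [->|[r ->]]; last by rewrite IH.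
  by exists 0; rewrite mulr0 mul0r.
have [n nP] := T_ann y.
have [Tu [uu _ _]] := uP n; have [yn0 yu _] := yP n.
apply: yn0; rewrite -yu -[u n]uu; apply: nP => // k kn.
by have := y_ann k (n - k.+1)%N 1; rewrite mulr1 addnS -addSn subnKC.
Qed.

End IdempotentAlgebra.

(** * From filtrations to composition series *)

Section FiniteLength.
Variables (R : nzRingType) (e : nzidempotent R).
Local Notation ev := (idem_val e).
Let ee : ev * ev = ev := idemP e.
Hypothesis e_local : nil_or_unit ev.

Lemma in_corner (s : R) : ev * s * ev = s -> s \in corner_pred e.
Proof. by move=> hs; apply/asboolP; exists s. Qed.
Lemma in_Re (x : R) : x * ev = x -> x \in Re_pred e.
Proof. by move=> hx; apply/asboolP; exists x. Qed.
Lemma cornerK (a : corner e) : ev * (a : R) * ev = (a : R).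
Proof. by have [r ->] := corner_valP a; rewrite !mulrA ee -mulrA ee. Qed.
Lemma ReK (x : Re e) : (x : R) * ev = (x : R).
Proof. by have [r ->] := Re_valP x; rewrite -mulrA ee. Qed.

Definition Re_set (N : set R) : {pred Re e} := [pred y : Re e | `[< N (y : R) >]].

Lemma Re_setP N (y : Re e) : reflect (N (y : R)) (y \in Re_set N).
Proof. exact: asboolP. Qed.

Lemma Re_set_submodule N : corner_submodule ev N -> submodule (Re_set N).
Proof.
move=> sN; have [N0 NB NM Ne] := sN; split=> [|a u v]; first exact/Re_setP.
move=> /Re_setP Nu /Re_setP Nv; apply/Re_setP; apply: corner_submoduleD sN _ Nv.
by apply: NM Nu; exact: cornerK.
Qed.

(** Trivial steps are dropped; a step that adds something new is a simple one,
    because the units of the corner ring are exactly its elements that are not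
    nilpotent. *)
Lemma filtered_series N : filtered ev N -> exists (n : nat) (L : nat -> {pred Re e}),
  [/\ forall i, submodule (L i), L 0%N =i pred1 (0 : Re e), L n =i Re_set N &
    forall i, (i < n)%N -> maximal_submodule (L i) (L i.+1)].
Proof.
elim=> [|{}N x fN [n [L [Lsub L0 Ln Lmax]]] xe xJ].
  exists 0%N, (fun=> Re_set [set 0]); split=> // [_|y].
    by apply: Re_set_submodule; exact/(filtered_submodule ee)/filtered_zero.
  apply/Re_setP/eqP => [y0|->] //; exact: val_inj.
have sN := filtered_submodule ee fN; have [N0 NB NM Ne] := sN.
set N' := [set y | _].
have fN' : filtered ev N' by exact: filtered_step.
have NN' y : N y -> N' y.
  by move=> Ny; exists y, 0; rewrite mulr0 mul0r mulr0 addr0.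
have [Nx|nNx] := pselect (N x).
  exists n, L; split=> // y; rewrite Ln.
  apply/Re_setP/Re_setP => [/NN'//|[z [s [Nz hs ->]]]].
  by apply: corner_submoduleD sN Nz _; exact: NM.
exists n.+1, (fun i => if (i <= n)%N then L i else Re_set N'); split.
- move=> i; case: ifP => _; first exact: Lsub.
  exact/Re_set_submodule/(filtered_submodule ee).
- by rewrite leq0n.
- by rewrite ltnn.
move=> i; rewrite ltnS => iln; rewrite iln.
have [lin|nli] := ltnP i n; first exact: Lmax.
have {i iln nli}-> : i = n by apply/eqP; rewrite eqn_leq iln.
pose x' : Re e := InRe (in_Re xe).
split.
- by move=> y; rewrite Ln => /Re_setP Ny; apply/Re_setP; exact: NN'.
- move=> /(_ x'); rewrite Ln => h; apply: nNx; apply: (elimT (Re_setP N x')); apply: h.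
  apply/Re_setP; exists 0, ev; rewrite /= add0r xe ee.
  by split=> //; rewrite ee.
move=> P [P0 Psub] LP PN'.
have PD (u v : Re e) : u \in P -> v \in P -> u + v \in P.
  by move=> Pu Pv; have := Psub 1 _ _ Pu Pv; rewrite scale1r.
have PZ a (u : Re e) : u \in P -> a *: u \in P.
  by move=> Pu; rewrite -[_ *: _]addr0; exact: Psub.
have [PN|] := pselect (forall y, y \in P -> y \in L n).
  by left=> y; apply/idP/idP => [/PN//|/LP].
move=> /existsNP[z /not_implyP[Pz nLz]]; right=> y; apply/idP/idP => [/PN'//|].
move=> /Re_setP[m [t [Nm ht yE]]].
have nNz : ~ N (z : R) by move=> Nz; apply: nLz; rewrite Ln; exact/Re_setP.
have /Re_setP[k [s [Nk hs zE]]] := PN' _ Pz.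
have [[j sj]|[s' [hs' ss' _]]] := e_local hs.
  by case: nNz; rewrite zE; apply: corner_submoduleD sN Nk _; exact: xJ sj.
pose c (a : R) (ha : ev * a * ev = a) : (corner e)^c := Corner (in_corner ha).
pose inN (a : R) (ha : N a) : Re e := InRe (in_Re (Ne _ ha)).
have inP a (ha : N a) : inN a ha \in P.
  by apply: LP; rewrite Ln; exact/Re_setP.
have Px : x' \in P.
  have -> : x' = c _ hs' *: z - c _ hs' *: inN _ Nk.
    apply/val_inj; rewrite /= zE mulrDl -mulrA ss' xe.
    by rewrite -[RHS]/(k * s' + x - k * s') addrC addKr.
  by apply: (PD); [exact: PZ | rewrite -scaleN1r; do 2 apply: (PZ)].
have -> : y = inN _ Nm + c _ ht *: x' by apply/val_inj.
by apply: PD => //; exact: PZ.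
Qed.

Lemma filtered_finite_length : filtered ev (cyclic_Re ev 1) -> finite_length (Re e).
Proof.
move=> /filtered_series[n [L [Lsub L0 Ln Lmax]]]; exists n, L; split=> // y.
by rewrite Ln; apply/Re_setP; exists (y : R); rewrite mul1r ReK.
Qed.

End FiniteLength.

(** * Modules with a complete separable metric *)

Lemma dependent_choice (X : Type) (P : seq X -> X -> Prop) :
  (forall s, exists x, P s x) -> exists f : nat -> X, forall n, P (mkseq f n) (f n).
Proof.
move=> /choice[g gP].
pose hist n := iter n (fun s => rcons s (g s)) [::].
exists (fun n => g (hist n)) => n.
suff -> : mkseq (fun n => g (hist n)) n = hist n by exact: gP.
by elim: n => // n IH; rewrite mkseqS IH.
Qed.

(** The state of a construction satisfies the invariant [I], and [S] records what
    each step achieves. *)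
Lemma state_choice (X : Type) (I : nat -> X -> Prop) (S : nat -> X -> X -> Prop) x0 :
  I 0%N x0 -> (forall n x, I n x -> exists2 y, I n.+1 y & S n x y) ->
  exists f : nat -> X, f 0%N = x0 /\ forall n, I n (f n) /\ S n (f n) (f n.+1).
Proof.
move=> I0 step.
have step' (p : nat * X) : exists y, I p.1 p.2 -> I p.1.+1 y /\ S p.1 p.2 y.
  have [/step[y Iy Sy]|nI] := pselect (I p.1 p.2); first by exists y.
  by exists x0 => /nI.
have [g gP] := choice step'.
pose f := fix f n := if n is m.+1 then g (m, f m) else x0.
exists f; split=> // n; suff If : I n (f n) by split=> //; have [] := gP (n, f n) If.
by elim: n => //= n IH; have [] := gP (n, f n) IH.
Qed.

Section MetricModule.
Import Order.TTheory Num.Theory.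
Variables (K : realType) (R : nzRingType) (A : lmodType R) (d : A -> A -> K).

Definition dconv (u : nat -> A) (l : A) : Prop :=
  forall eps, 0 < eps -> exists N, forall n, (N <= n)%N -> d l (u n) < eps.

(** The consequences, for the underlying module, of a complete separable metric
    compatible with the module structure.  The metric need not be invariant
    under translations. *)
Record metric_module : Prop := MetricModule {
  d_refl : forall x, d x x = 0;
  d_eq : forall x y, d x y = 0 -> x = y;
  d_sym : forall x y, d x y = d y x;
  d_tri : forall y x z, d x z <= d x y + d y z;
  d_complete : forall u : nat -> A,
    (forall eps, 0 < eps -> exists n0, forall m n,
      (n0 <= m)%N -> (n0 <= n)%N -> d (u m) (u n) < eps) -> exists l, dconv u l;
  d_add : forall x y eps, 0 < eps -> exists2 del, 0 < del &
    forall x' y', d x x' < del -> d y y' < del -> d (x + y) (x' + y') < eps;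
  d_scale : forall r x eps, 0 < eps -> exists2 del, 0 < del &
    forall x', d x x' < del -> d (r *: x) (r *: x') < eps;
  d_dense : exists D : nat -> A, forall x eps, 0 < eps -> exists n, d x (D n) < eps }.

Hypothesis dM : metric_module.

Lemma d_ge0 x y : 0 <= d x y.
Proof.
have := d_tri dM y x x; rewrite (d_refl dM) (d_sym dM y x); lra.
Qed.

Lemma conv_uniq u l l' : dconv u l -> dconv u l' -> l = l'.
Proof.
move=> ul ul'; apply: (d_eq dM).
have [e0|e0|//] := ltgtP 0 (d l l'); last by have := d_ge0 l l'; lra.
have e2 : 0 < d l l' / 2 by lra.
have [N NP] := ul _ e2; have [N' NP'] := ul' _ e2.
have h1 := NP _ (leq_maxl N N'); have h2 := NP' _ (leq_maxr N N').
have := d_tri dM (u (maxn N N')) l l'; rewrite (d_sym dM (u _)); lra.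
Qed.

Lemma conv_add u v l m : dconv u l -> dconv v m -> dconv (fun n => u n + v n) (l + m).
Proof.
move=> ul vm e /(d_add dM l m)[del del0 delP].
have [N NP] := ul _ del0; have [N' NP'] := vm _ del0.
exists (maxn N N') => n; rewrite geq_max => /andP[Nn N'n].
by apply: delP; [exact: NP | exact: NP'].
Qed.

Lemma conv_scale r u l : dconv u l -> dconv (fun n => r *: u n) (r *: l).
Proof.
move=> ul e /(d_scale dM r l)[del del0 delP].
by have [N NP] := ul _ del0; exists N => n /NP; exact: delP.
Qed.

Lemma conv_cst l : dconv (fun=> l) l.
Proof. by move=> e e0; exists 0%N => n _; rewrite (d_refl dM). Qed.

Lemma conv_ext N u v l : (forall n, (N <= n)%N -> u n = v n) -> dconv u l -> dconv v l.
Proof.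
move=> uv ul e /ul[M MP]; exists (maxn M N) => n; rewrite geq_max => /andP[Mn Nn].
by rewrite -uv //; exact: MP.
Qed.

Lemma conv_sum n (k : nat -> R) (u : nat -> nat -> A) (l : nat -> A) :
  (forall j, (j < n)%N -> dconv (u^~ j) (l j)) ->
  dconv (fun i => \sum_(j < n) k j *: u i j) (\sum_(j < n) k j *: l j).
Proof.
elim: n => [_|n IH ul].
  rewrite big_ord0; apply: (@conv_ext 0%N (fun=> 0)) (conv_cst _).
  by move=> n _; rewrite big_ord0.
rewrite big_ord_recr; have /IH h : forall j, (j < n)%N -> dconv (u^~ j) (l j).
  by move=> j jn; apply: ul; exact: ltnW.
have := conv_add h (conv_scale (k n) (ul n (ltnSn n))).
by apply: (@conv_ext 0%N) => i _ /=; rewrite big_ord_recr.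
Qed.

Definition half_pow n : K := 2^-1 ^+ n.
Lemma half_pow_gt0 n : 0 < half_pow n.
Proof. by rewrite /half_pow exprn_gt0 // invr_gt0. Qed.
Lemma half_powS n : half_pow n.+1 = half_pow n / 2.
Proof. by rewrite /half_pow exprSr. Qed.
Lemma half_pow_lim e : 0 < e -> exists N, forall n, (N <= n)%N -> half_pow n < e.
Proof.
move=> e0; exists (Num.bound e^-1) => n Nn.
rewrite /half_pow exprVn invf_plt ?posrE ?exprn_gt0 //.
apply: (lt_trans (archi_boundP _)); first by rewrite invr_ge0 ltW.
by rewrite -natrX ltr_nat; apply: leq_ltn_trans Nn _; exact: ltn_expl.
Qed.

Lemma conv_geo u : (forall n, d (u n) (u n.+1) < half_pow n) -> exists l, dconv u l.
Proof.
move=> uP; apply: (d_complete dM) => e e0.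
have e4 : 0 < e / 4 by lra.
have [N NP] := half_pow_lim e4.
have tail k : d (u N) (u (N + k)%N) <= 2 * half_pow N - 2 * half_pow (N + k).
  elim: k => [|k IH]; first by rewrite addn0 (d_refl dM) subrr.
  have := d_tri dM (u (N + k)%N) (u N) (u (N + k.+1)%N).
  have := uP (N + k)%N; rewrite addnS half_powS; lra.
have close n : (N <= n)%N -> d (u N) (u n) < e / 2.
  move=> /subnKC <-; have := tail (n - N)%N; have := NP N (leqnn N).
  have := half_pow_gt0 (N + (n - N)); lra.
exists N => m n /close hm /close hn.
have := d_tri dM (u N) (u m) (u n); rewrite (d_sym dM (u m) (u N)); lra.
Qed.

Lemma d_small x r eps : 0 < eps -> exists2 del, 0 < del &
  forall v, d 0 v < del -> d x (x + r *: v) < eps.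
Proof.
move=> /(d_add dM x 0)[d1 d10 d1P]; have [d2 d20 d2P] := d_scale dM r 0 d10.
exists d2 => // v /d2P; rewrite scaler0 => vP.
by rewrite -{1}[x]addr0; apply: d1P => //; rewrite (d_refl dM).
Qed.

Lemma d_translate g x eps : 0 < eps -> exists2 del, 0 < del &
  forall w, d x w < del -> d (x + g) (w + g) < eps.
Proof.
move=> /(d_add dM x g)[d1 d10 d1P]; exists d1 => // w xw; apply: d1P => //.
by rewrite (d_refl dM).
Qed.

Lemma d_diff eps : 0 < eps -> exists2 del, 0 < del &
  forall v w, d 0 v < del -> d 0 w < del -> d 0 (v - w) < eps.
Proof.
move=> /(d_add dM 0 0)[d1 d10 d1P]; have [d2 d20 d2P] := d_scale dM (-1) 0 d10.
exists (Num.min d1 d2); first by rewrite lt_min d10.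
move=> v w; rewrite !lt_min => /andP[v1 _] /andP[_ /d2P].
by rewrite scaler0 scaleN1r => w1; rewrite -[X in d X _]addr0; exact: d1P.
Qed.

Lemma fin_min n (P : nat -> K -> Prop) :
  (forall j d1 d2, P j d1 -> d2 <= d1 -> P j d2) ->
  (forall j, (j < n)%N -> exists2 e, 0 < e & P j e) ->
  exists2 e, 0 < e & forall j, (j < n)%N -> P j e.
Proof.
move=> mono; elim: n => [_|n IH h]; first by exists 1.
have [|e1 e10 e1P] := IH; first by move=> j jn; apply: h; exact: ltnW.
have [e2 e20 e2P] := h n (ltnSn n).
exists (Num.min e1 e2); first by rewrite lt_min e10.
move=> j; rewrite ltnS leq_eqVlt => /predU1P[->|jn].
  by apply: mono e2P _; rewrite ge_min lexx orbT.
by apply: mono (e1P j jn) _; rewrite ge_min lexx.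
Qed.

(** Separability: translates of a small ball around a countable dense set cover
    the module, and the color of a point is the index of a translate that
    contains it. *)
Lemma d_coloring eps : 0 < eps -> exists chi : A -> nat,
  forall a b, chi a = chi b -> d 0 (a - b) < eps.
Proof.
move=> /d_diff[del del0 delP]; have [D DP] := d_dense dM.
have near a : exists n, d 0 (a - D n) < del.
  have [e1 e10 e1P] := d_add dM a (- a) del0.
  have [e2 e20 e2P] := d_scale dM (-1) a e10.
  have [n nP] := DP a _ e20; exists n; rewrite -[X in d X _](subrr a); apply: e1P.
    by rewrite (d_refl dM).
  by have := e2P _ nP; rewrite !scaleN1r.
have [chi chiP] := choice near.
exists chi => a b ab; have := delP _ _ (chiP a) (chiP b).
by rewrite ab opprB addrA subrK.
Qed.

End MetricModule.

(** * Coordinates on an uncountable module *)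

Lemma uncountable_fiber (A : Type) (B : set A) (chi : A -> nat) :
  ~ countable B -> exists n, ~ countable (B `&` chi @^-1` [set n]).
Proof.
move=> ncB; apply: contrapT => /forallNP h; apply: ncB.
have -> : B = \bigcup_(n in setT) (B `&` chi @^-1` [set n]).
  by apply/seteqP; split=> [x Bx|x [n _ []]//]; exists (chi x).
by apply: bigcup_countable => [|n _]; [exact: countableP | apply: contrapT; exact: h].
Qed.

Lemma uncountable_nonempty (A : Type) (B : set A) : ~ countable B -> exists x, B x.
Proof.
by move=> ncB; apply: contrapT => /forallNP h; apply: ncB;
  have -> : B = set0 by apply/seteqP; split=> // x /h.
Qed.

Lemma uncountable_avoid (A : choiceType) (B : set A) (s : seq A) :
  ~ countable B -> exists2 x, B x & x \notin s.
Proof.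
move=> ncB; apply: contrapT => h; apply: ncB.
apply: (@sub_countable _ _ _ [set` s]); last exact: finite_set_countable.
apply: subset_card_le => x Bx /=; apply: contrapT => xs; apply: h.
by exists x => //; exact/negP.
Qed.

Section Coordinates.
Import Order.TTheory Num.Theory.
Variables (R : nzRingType) (A : lmodType R) (c : A -> A -> R) (supp : A -> seq A).

(** A dual basis indexed by the points of the module itself, as it is obtained
    from the canonical projection of the free module on [A] onto [A]. *)
Record coordinates : Prop := Coordinates {
  coord_lin : forall b r x y, c b (r *: x + y) = r * c b x + c b y;
  coord_supp : forall b x, b \notin supp x -> c b x = 0;
  coord_rep : forall x, x = \sum_(b <- supp x) c b x *: b }.

Hypothesis cP : coordinates.

Lemma coordD b x y : c b (x + y) = c b x + c b y.
Proof. by rewrite -[x in LHS]scale1r (coord_lin cP) mul1r. Qed.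
Lemma coord0 b : c b 0 = 0.
Proof. by apply: (addrI (c b 0)); rewrite -coordD !addr0. Qed.
Lemma coordZ b r x : c b (r *: x) = r * c b x.
Proof. by rewrite -[_ *: _]addr0 (coord_lin cP) coord0 addr0. Qed.
Lemma coordB b x y : c b (x - y) = c b x - c b y.
Proof. by rewrite coordD -scaleN1r coordZ mulN1r. Qed.
Lemma coord_sum b n (k : nat -> R) (s : nat -> A) :
  c b (\sum_(j < n) k j *: s j) = \sum_(j < n) k j * c b (s j).
Proof.
elim: n => [|n IH]; first by rewrite !big_ord0 coord0.
by rewrite !big_ord_recr coordD IH coordZ.
Qed.

Hypothesis (R_countable : countable [set: R]) (A_uncountable : ~ countable [set: A]).

Definition big_value (u : R) : Prop := ~ countable [set b | exists a, c b a = u].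

Definition small_index : set A := [set b | exists a, ~ big_value (c b a)].

Lemma small_index_countable : countable small_index.
Proof.
have sub : small_index `<=` \bigcup_(u in [set u | ~ big_value u])
    [set b | exists a, c b a = u].
  by move=> b [a na]; exists (c b a) => //; exists a.
apply: (sub_countable (subset_card_le sub)).
apply: bigcup_countable => [|u /contrapT//].
by apply: sub_countable R_countable; exact: subset_card_le.
Qed.

Lemma big_value_lmul r u : big_value u -> big_value (r * u).
Proof.
move=> bu cru; apply: bu; apply: sub_countable cru; apply: subset_card_le.
by move=> b [a <-]; exists (r *: a); rewrite coordZ.
Qed.

(** Finitely supported functions from a countable set to a countable ring form a
    countable set. *)
Lemma small_index_coloring : exists chi : A -> nat, forall x y, chi x = chi y ->
  forall b, small_index b -> c b x = c b y.
Proof.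
have /countable_injP[f fi] := small_index_countable.
have /countable_injP[g gi] := R_countable.
pose code x := [seq (f b, g (c b x)) | b <- supp x & `[< small_index b >]].
have half x y : code x = code y -> forall b, small_index b -> b \in supp x ->
    c b x = c b y.
  move=> xy b Cb bx.
  have : (f b, g (c b x)) \in code x.
    by apply/mapP; exists b => //; rewrite mem_filter bx andbT; exact/asboolP.
  rewrite xy => /mapP[b']; rewrite mem_filter => /andP[/asboolP Cb' b'y] [fb gb].
  have bb' : b = b' by apply: fi => //; rewrite inE.
  by move: gb; rewrite -bb'; apply: gi; rewrite inE.
exists (fun x => pickle (code x)) => x y /(pcan_inj pickleK) xy b Cb.
have [bx|nbx] := boolP (b \in supp x); first exact: half.
have [b_y|nby] := boolP (b \in supp y); first exact/esym/half.
by rewrite !(coord_supp cP).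
Qed.

Variables (K : realType) (d : A -> A -> K).
Hypothesis dM : metric_module d.

(** An uncountable family has an uncountable subfamily of a single color, and all
    but finitely many of its indices avoid the support of a given member. *)
Lemma small_difference (B : set A) (alpha : A -> A) (F : seq A) eps :
  ~ countable B -> 0 < eps -> exists b b',
    [/\ B b, B b', b \notin F & c b (alpha b') = 0] /\
    (d 0 (alpha b - alpha b') < eps /\
     forall i, small_index i -> c i (alpha b - alpha b') = 0).
Proof.
move=> ncB /(d_coloring dM)[chi1 chi1P]; have [chi2 chi2P] := small_index_coloring.
pose chi b := pickle (chi1 (alpha b), chi2 (alpha b)).
have [n ncn] := uncountable_fiber chi ncB.
have [b' [Bb' chib']] := uncountable_nonempty ncn.
have [b [Bb chib]] := uncountable_avoid (F ++ supp (alpha b')) ncn.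
rewrite mem_cat negb_or => /andP[bF bs].
have [h1 h2] : (chi1 (alpha b), chi2 (alpha b)) = (chi1 (alpha b'), chi2 (alpha b')).
  by apply: (pcan_inj pickleK); rewrite -/(chi b) -/(chi b') chib chib'.
exists b, b'; split; first by split=> //; exact: (coord_supp cP).
by split; [exact: chi1P | move=> i Ci; rewrite coordB (chi2P _ _ h2) // subrr].
Qed.

(** The argument of Chase on direct products inside direct sums, with small
    series in place of arbitrary products.  The subgroups that decrease are
    [x_n {a | Y_n a = 0}], where [x_(n+1) = x_n t_n] and [Y_n t_n] is contained
    in [Y_(n+1)]. *)
Section Chase.
Variables (x t : nat -> R) (Y : nat -> set R).
Hypotheses (xS : forall n, x n.+1 = x n * t n)
  (YS : forall n y, Y n y -> Y n.+1 (y * t n)).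

Let bad n (u : R) := ~ exists h, (forall y, Y n.+1 y -> y * h = 0) /\ u = x n.+1 * h.

Let p n k := \prod_(n <= i < k) t i.

Lemma chase_annihilator n k y : (n <= k)%N -> Y n y -> Y k (y * p n k).
Proof.
move=> /subnKC <- Yy; elim: (k - n)%N => [|m IH].
  by rewrite addn0 /p big_geq // mulr1.
by rewrite addnS /p big_nat_recr ?leq_addr //= mulrA; exact: YS.
Qed.

(** Suppose that the chain never stabilizes.  Choose [v_n] with [Y_n v_n = 0],
    small, and with a coordinate [b_n] such that [c_(b_n) (x_n v_n)] is not in
    the next right ideal while [c_(b_n)] vanishes on [v_0, ..., v_(n-1)].  The
    series [w_n = v_n + t_n w_(n+1)] converge, and
    [x_0 w_0 = sum_(k < n) x_k v_k + x_n w_n] shows that [c_(b_n) (x_0 w_0)] is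
    nonzero for every [n]: too many nonzero coordinates. *)
Lemma chase :
  ~ forall n, exists z u, [/\ forall y, Y n y -> y * z = 0, big_value u &
      bad n (x n * (z * u))].
Proof.
move=> hbad.
have step (s : seq A) : exists v, [/\
    (forall y, Y (size s) y -> y *: v = 0),
    (exists2 b, bad (size s) (c b (x (size s) *: v)) &
       forall w, w \in s -> c b w = 0) &
    forall n W, (n <= size s)%N -> W = \sum_(n <= k < size s) p n k *: s`_k ->
       d W (W + p n (size s) *: v) < half_pow K (size s)].
  have [z [u [Yz bu zu]]] := hbad (size s).
  (* v must move each partial sum built so far by less than 2^-(size s) *)
  have [del del0 delP] := @fin_min K (size s).+1 (fun n e => forall v, d 0 v < e ->
      let W := \sum_(n <= k < size s) p n k *: s`_k in
      d W (W + p n (size s) *: v) < half_pow K (size s))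
    (fun j d1 d2 h d21 v hv => h v (lt_le_trans hv d21))
    (fun n _ => d_small dM _ _ (half_pow_gt0 K _)).
  have /choice[al alP] b : exists a', (exists a, c b a = u) -> c b a' = u.
    by have [[a <-]|n] := pselect (exists a, c b a = u); [exists a|exists 0].
  have [b [b' [[ub ub' bF bb'] [small _]]]] :=
    small_difference (fun b => z *: al b) (flatten (map supp s)) bu del0.
  exists (z *: al b - z *: al b'); split.
  - by move=> y /Yz yz; rewrite scalerBr !scalerA yz !scale0r subrr.
  - exists b.
      by rewrite coordZ coordB bb' subr0 coordZ alP.
    move=> w ws; apply: (coord_supp cP); apply: contra bF => bw.
    by apply/flattenP; exists (supp w) => //; exact: map_f.
  - by move=> n W ns ->; exact: delP.
have [v vP] := dependent_choice step.
have vann n y : Y n y -> y *: v n = 0.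
  by have [h _ _] := vP n; rewrite size_mkseq in h; exact: h.
have /choice[b bP] n : exists b, bad n (c b (x n *: v n)) /\
    forall k, (k < n)%N -> c b (v k) = 0.
  have [_ [b bb bs] _] := vP n; rewrite size_mkseq in bb.
  by exists b; split=> // k kn; apply: bs; apply/mapP; exists k; rewrite ?mem_iota.
(* the partial sums of w_n = v_n + t_n v_(n+1) + t_n t_(n+1) v_(n+2) + ... *)
pose W n i := \sum_(n <= k < i) p n k *: v k.
have WE n i : W n i = \sum_(n <= k < i) p n k *: (mkseq v i)`_k.
  by apply: eq_big_nat => k /andP[_ ki]; rewrite nth_mkseq.
have Wstep n i : d (W n i) (W n i.+1) < half_pow K i.
  have [ni|ni] := leqP n i.
    rewrite {2}/W big_nat_recr //= -/(W n i).
    by have [_ _ h] := vP i; rewrite size_mkseq in h; exact: h.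
  by rewrite /W !big_geq ?(d_refl dM) ?half_pow_gt0 // ltnW.
have /choice[w wP] n : exists w, dconv d (W n) w by exact: conv_geo.
have wrec n : w n = v n + t n *: w n.+1.
  apply: (conv_uniq dM (wP n)).
  have := conv_add dM (conv_cst dM (v n)) (conv_scale dM (t n) (wP n.+1)).
  apply: (@conv_ext _ _ _ _ n.+1) => i ni /=.
  rewrite [RHS]/W big_ltn // {1}/p big_geq // scale1r scaler_sumr; congr (_ + _).
  by apply: eq_big_nat => k /andP[nk _]; rewrite scalerA /p [in RHS]big_ltn.
have wann n y : Y n y -> y *: w n = 0.
  move=> Yy; apply: (conv_uniq dM (conv_scale dM y (wP n))).
  apply: (@conv_ext _ _ _ _ 0%N (fun=> 0)) (conv_cst dM 0) => i _.
  rewrite /W scaler_sumr big_nat big1 // => k /andP[nk _].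
  by rewrite scalerA; apply: vann; exact: chase_annihilator.
have aE n : x 0%N *: w 0%N = \sum_(0 <= k < n) x k *: v k + x n *: w n.
  elim: n => [|n IH]; first by rewrite big_geq // add0r.
  by rewrite IH big_nat_recr //= {1}wrec scalerDr scalerA -xS addrA.
have cb n : c (b n) (x 0%N *: w 0%N) <> 0.
  have [bb bs] := bP n; rewrite (aE n) coordD.
  have -> : c (b n) (\sum_(0 <= k < n) x k *: v k) = 0.
    by rewrite big_mkord coord_sum big1 // => k _; rewrite bs ?mulr0.
  rewrite add0r wrec scalerDr coordD scalerA -xS => e0; apply: bb.
  exists (- c (b n) (w n.+1)); split.
    by move=> y /wann yw; rewrite mulrN -coordZ yw coord0 oppr0.
  by apply/eqP; rewrite mulrN -addr_eq0 -coordZ e0.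
have binj : injective b.
  have lt m n : (m < n)%N -> b m <> b n.
    move=> mn bmn; have [_ bs] := bP n; have [bb _] := bP m.
    apply: bb; exists 0; split=> [y _|]; first by rewrite mulr0.
    by rewrite coordZ bmn bs // !mulr0.
  by move=> m n bmn; case: (ltngtP m n) => // /lt; rewrite bmn.
have : (size (mkseq b (size (supp (x 0%N *: w 0%N))).+1) <=
    size (supp (x 0%N *: w 0%N)))%N.
  apply: uniq_leq_size; first by rewrite map_inj_uniq ?iota_uniq.
  move=> _ /mapP[n _ ->]; apply: contrapT => /negP nb.
  by apply: (cb n); exact: (coord_supp cP).
by rewrite size_mkseq ltnn.
Qed.
End Chase.

End Coordinates.

(** * Baire category and open mappings *)

(** [Z] is a closed subgroup; all the density statements are relative to [Z]. *)
Section OpenMapping.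
Import Order.TTheory Num.Theory.
Variables (K : realType) (R : nzRingType) (A : lmodType R) (d : A -> A -> K).
Hypothesis dM : metric_module d.
Variable Z : set A.
Hypotheses (Z0 : Z 0) (ZB : forall x y, Z x -> Z y -> Z (x - y))
  (Z_closed : forall u l, (forall n : nat, Z (u n)) -> dconv d u l -> Z l).

Let ZD x y : Z x -> Z y -> Z (x + y).
Proof.
by move=> Zx Zy; rewrite -[y]opprK; apply: ZB => //; rewrite -sub0r; exact: ZB.
Qed.

Definition nowhere_dense_in (F : set A) : Prop := forall z eps, Z z -> 0 < eps ->
  exists z' eps', [/\ Z z', 0 < eps', d z z' < eps &
    forall y, Z y -> d z' y < eps' -> ~ F y].

Lemma nowhere_dense_translate F g : Z g -> nowhere_dense_in F ->
  nowhere_dense_in [set z | F (z - g)].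
Proof.
move=> Zg Fnd z eps Zz eps0.
have [e1 e10 e1P] := d_translate dM g (z - g) eps0.
have [z' [e2 [Zz' e20 zz' z'P]]] := Fnd _ _ (ZB Zz Zg) e10.
have [e3 e30 e3P] := d_translate dM (- g) (z' + g) e20.
exists (z' + g), e3; split=> //; first exact: ZD.
  by have := e1P _ zz'; rewrite subrK.
move=> y Zy /e3P; rewrite addrK => h /=; apply: z'P => //; exact: ZB.
Qed.

Lemma baire (F : nat -> set A) : (forall k, nowhere_dense_in (F k)) ->
  exists2 z, Z z & forall k, ~ F k z.
Proof.
move=> Fnd.
have [||f [_ fP]] := @state_choice (A * K) (fun n p => [/\ Z p.1, 0 < p.2 & p.2 <= half_pow K n])
  (fun n p q => [/\ d p.1 q.1 + q.2 <= p.2, d p.1 q.1 < half_pow K n &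
    forall y, Z y -> d q.1 y <= q.2 -> ~ F n y]) (0, 1).
- by split=> //=; rewrite /half_pow expr0.
- move=> n [z e] /= [Zz e0 en]; have e2 : 0 < e / 2 by lra.
  have [z' [e' [Zz' e'0 zz' z'P]]] := Fnd n _ _ Zz e2.
  exists (z', Num.min (e / 2) (e' / 2)) => /=.
    split=> //; first by rewrite lt_min e2 /=; lra.
    by rewrite half_powS ge_min; apply/orP; left; lra.
  have h1 : Num.min (e / 2) (e' / 2) <= e / 2 by rewrite ge_min lexx.
  have h2 : Num.min (e / 2) (e' / 2) <= e' / 2 by rewrite ge_min lexx orbT.
  by split; [lra | lra | move=> y Zy yz'; apply: z'P => //; lra].
pose z n := (f n).1; pose e n := (f n).2.
have [l zl] : exists l, dconv d z l.
  by apply: (conv_geo dM) => n; have [_ []] := fP n.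
have nest n k : d (z n) (z (n + k)%N) + e (n + k)%N <= e n.
  elim: k => [|k IH]; first by rewrite addn0 (d_refl dM) add0r.
  have [_ [h _ _]] := fP (n + k)%N; rewrite addnS.
  have := d_tri dM (z (n + k)%N) (z n) (z (n + k).+1); rewrite /z /e in IH h *; lra.
have close n : d (z n) l <= e n.
  rewrite leNgt; apply/negP => h; have h0 : 0 < d (z n) l - e n by lra.
  have [N NP] := zl _ h0.
  have := NP _ (leq_addl n N); have := nest n N.
  have [[_ e0 _] _] := fP (n + N)%N.
  have := d_tri dM (z (n + N)%N) (z n) l; rewrite (d_sym dM (z (n + N)%N) l) -/(e _) in e0 *; lra.
exists l; first by apply: Z_closed zl => n; have [[]] := fP n.
move=> k; have [_ [_ _ h]] := fP k; apply: h (close k.+1).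
by apply: Z_closed zl => n; have [[]] := fP n.
Qed.

Variable k : nat -> R.
Hypothesis kZ : forall j a, Z (k j *: a).

Definition lincomb n (s : nat -> A) : A := \sum_(j < n) k j *: s j.

Lemma lincombB n s s' : lincomb n (fun j => s j - s' j) = lincomb n s - lincomb n s'.
Proof. by rewrite /lincomb -sumrB; apply: eq_bigr => j _; rewrite scalerBr. Qed.

Lemma lincombD n s s' : lincomb n (fun j => s j + s' j) = lincomb n s + lincomb n s'.
Proof. by rewrite /lincomb -big_split; apply: eq_bigr => j _; rewrite scalerDr. Qed.

Lemma lincomb_Z n s : Z (lincomb n s).
Proof. by rewrite /lincomb; elim/big_rec: _ => // j x _ Zx; apply: ZD. Qed.

Definition small_image n del : set A :=
  [set y | exists2 s, (forall j, (j < n)%N -> d 0 (s j) < del) & y = lincomb n s].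

(** The image of a small neighborhood of [0] is dense in some ball; translate this
    ball to [lincomb n s].  The corrections to [s] are the differences [a - a0] of
    two points of the neighborhood. *)
Lemma thick_image n : (forall del, 0 < del -> ~ nowhere_dense_in (small_image n del)) ->
  forall s eta, 0 < eta -> exists2 rho, 0 < rho & forall w, Z w -> d (lincomb n s) w < rho ->
    forall eps, 0 < eps -> exists2 s', (forall j, (j < n)%N -> d (s j) (s' j) < eta) &
      d w (lincomb n s') < eps.
Proof.
move=> thick s eta eta0.
have [del del0 delP] : exists2 del, 0 < del & forall j, (j < n)%N ->
    forall a a', d 0 a < del -> d 0 a' < del -> d (s j) (s j + (a - a')) < eta.
  apply: fin_min => [j d1 d2 h d21 a a' ha ha'|j _].
    by apply: h; [exact: lt_le_trans ha _ | exact: lt_le_trans ha' _].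
  have [e1 e10 e1P] := d_small dM (s j) 1 eta0.
  have [e2 e20 e2P] := d_diff dM e10.
  exists e2 => // a a' ha ha'; rewrite -[a - a']scale1r; apply: e1P; exact: e2P.
have [z [eps0 [Zz eps00 zP]]] : exists z eps, [/\ Z z, 0 < eps &
    forall z' eps', Z z' -> 0 < eps' -> d z z' < eps ->
      exists y, [/\ Z y, d z' y < eps' & small_image n del y]].
  apply: contrapT => h; apply: (thick _ del0) => z eps Zz eps0.
  apply: contrapT => h'; apply: h; exists z, eps; split=> // z' eps' Zz' eps'0 zz'.
  apply: contrapT => h''; apply: h'; exists z', eps'; split=> // y Zy z'y Fy.
  by apply: h''; exists y.
have [|y0 [Zy0 zy0 [a0 a0P y0E]]] := zP z eps0 Zz eps00; first by rewrite (d_refl dM).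
have gap : 0 < eps0 - d z y0 by lra.
have [rho rho0 rhoP] := d_translate dM (y0 - lincomb n s) (lincomb n s) gap.
exists rho => // w Zw /rhoP; rewrite addrC subrK => hw eps eps_gt0.
set w' := w + _ in hw.
have Zw' : Z w' by apply: ZD => //; apply: ZB => //; exact: lincomb_Z.
have [e1 e10 e1P] := d_translate dM (lincomb n s - y0) w' eps_gt0.
have [|y [Zy w'y [a aP yE]]] := zP w' e1 Zw' e10.
  have := d_tri dM y0 z w'; lra.
exists (fun j => s j + (a j - a0 j)) => [j jn|].
  by apply: delP => //; [exact: aP | exact: a0P].
rewrite lincombD lincombB -yE -y0E addrCA.
have <- : w' + (lincomb n s - y0) = w; last exact: e1P.
by rewrite /w' -addrA [_ - _ + _]addrA subrK subrr addr0.
Qed.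

(** Successive approximations.  As the metric is not assumed invariant, the
    radius allowed at a point is known only after this point is chosen, so
    [w0] cannot be approximated directly.  Instead one builds two sequences [s]
    and [s'] with [lincomb n s] and [w0 + lincomb n s'] approaching each other,
    each of them in turn correcting the error of the other. *)
Lemma open_image n : (forall del, 0 < del -> ~ nowhere_dense_in (small_image n del)) ->
  exists2 del, 0 < del & forall w, Z w -> d 0 w < del -> exists s, w = lincomb n s.
Proof.
move=> /thick_image thick.
have [rho rhoP] : exists rho : (nat -> A) -> nat -> K, forall s i,
    [/\ 0 < rho s i, rho s i <= half_pow K i & forall w, Z w -> d (lincomb n s) w < rho s i ->
    forall eps, 0 < eps -> exists2 s',
      (forall j, (j < n)%N -> d (s j) (s' j) < half_pow K i) & d w (lincomb n s') < eps].
  have /choice[f fP] (p : (nat -> A) * nat) : exists r,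
      [/\ 0 < r, r <= half_pow K p.2 & forall w, Z w -> d (lincomb n p.1) w < r ->
      forall eps, 0 < eps -> exists2 s',
      (forall j, (j < n)%N -> d (p.1 j) (s' j) < half_pow K p.2) & d w (lincomb n s') < eps].
    have [r r0 rP] := thick p.1 _ (half_pow_gt0 K p.2).
    exists (Num.min r (half_pow K p.2)); split.
    - by rewrite lt_min r0 half_pow_gt0.
    - by rewrite ge_min lexx orbT.
    - by move=> w Zw; rewrite lt_min => /andP[wr _]; exact: rP.
  by exists (fun s i => f (s, i)) => s i; exact: (fP (s, i)).
pose s0 : nat -> A := fun=> 0.
have s00 : lincomb n s0 = 0 by rewrite /lincomb big1 // => j _; rewrite scaler0.
exists (rho s0 0%N); first by have [] := rhoP s0 0%N.
move=> w0 Zw0 w0r.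
have thick' s i : exists2 r, 0 < r & forall w, Z w -> d (w0 + lincomb n s) w < r ->
    forall eps, 0 < eps -> exists2 s',
      (forall j, (j < n)%N -> d (s j) (s' j) < half_pow K i) & d w (w0 + lincomb n s') < eps.
  have [r0 _ rP] := rhoP s i.
  have [e1 e10 e1P] := d_translate dM (- w0) (w0 + lincomb n s) r0.
  exists e1 => // w Zw /e1P; rewrite addrC addKr => h eps eps0.
  have [e2 e20 e2P] := d_translate dM w0 (w - w0) eps0.
  have [s' ss' /e2P] := rP _ (ZB Zw Zw0) h e2 e20.
  by rewrite subrK addrC => h'; exists s'.
have [||f [_ fP]] := @state_choice ((nat -> A) * (nat -> A))
  (fun i p => d (lincomb n p.1) (w0 + lincomb n p.2) < rho p.1 i)
  (fun i p q => forall j, (j < n)%N ->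
     d (p.1 j) (q.1 j) < half_pow K i /\ d (p.2 j) (q.2 j) < half_pow K i)
  (s0, s0).
- by rewrite /= s00 addr0.
- move=> i [s s'] /= h.
  have [r' r'0 r'P] := thick' s' i.
  have [_ _ rP] := rhoP s i.
  have [s1 ss1 h1] := rP _ (ZD Zw0 (lincomb_Z n s')) h r' r'0.
  have [r1 _ _] := rhoP s1 i.+1.
  have [s1' ss1' h1'] := r'P _ (lincomb_Z n s1) h1 _ r1.
  by exists (s1, s1') => //= j jn; split; [exact: ss1 | exact: ss1'].
have /choice[g gP] j : exists g : A, (j < n)%N -> dconv d (fun i => (f i).1 j) g.
  have [jn|] := ltnP j n; last by exists 0.
  have [|g gP] := conv_geo dM (u := fun i => (f i).1 j); last by exists g.
  by move=> i; have [_ /(_ j jn)[]] := fP i.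
have /choice[g' g'P] j : exists g : A, (j < n)%N -> dconv d (fun i => (f i).2 j) g.
  have [jn|] := ltnP j n; last by exists 0.
  have [|g' g'P] := conv_geo dM (u := fun i => (f i).2 j); last by exists g'.
  by move=> i; have [_ /(_ j jn)[]] := fP i.
exists (fun j => g j - g' j); rewrite lincombB.
suff -> : lincomb n g = w0 + lincomb n g' by rewrite addrK.
have cg : dconv d (fun i => lincomb n (f i).1) (lincomb n g).
  exact: (conv_sum dM k (u := fun i => (f i).1) gP).
have cg' : dconv d (fun i => w0 + lincomb n (f i).2) (w0 + lincomb n g').
  apply: (conv_add dM (conv_cst dM w0)).
  exact: (conv_sum dM k (u := fun i => (f i).2) g'P).
apply: (conv_uniq dM cg) => e e0; have e2 : 0 < e / 2 by lra.
have [N1 N1P] := cg' _ e2; have [N2 N2P] := half_pow_lim e2.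
exists (maxn N1 N2) => i; rewrite geq_max => /andP[/N1P h1 /N2P h2].
have [h3 _] := fP i; have [_ h4 _] := rhoP (f i).1 i.
have := d_tri dM (w0 + lincomb n (f i).2) (w0 + lincomb n g') (lincomb n (f i).1).
rewrite (d_sym dM (w0 + lincomb n (f i).2) (lincomb n (f i).1)); lra.
Qed.

(** If the image of some neighborhood of [0] were nowhere dense for each [n],
    then [Z] would be covered by countably many translates of these images. *)
Lemma open_mapping (chi : A -> nat) :
  (forall z z', Z z -> Z z' -> chi z = chi z' -> exists n s, z - z' = lincomb n s) ->
  exists n, exists2 del, 0 < del &
    forall w, Z w -> d 0 w < del -> exists s, w = lincomb n s.
Proof.
move=> chiP; apply: contrapT => none.
have /choice[del delP] n : exists del, 0 < del /\ nowhere_dense_in (small_image n del).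
  apply: contrapT => h; apply: none; exists n; apply: open_image => del del0 nd.
  by apply: h; exists del.
have /choice[col colP] n : exists col : A -> nat,
    forall a b, col a = col b -> d 0 (a - b) < del n.
  by apply: (d_coloring dM); have [] := delP n.
have /choice[zr zrP] i : exists z, Z z /\ ((exists2 z', Z z' & chi z' = i) -> chi z = i).
  by have [[z' Zz' zi]|h] := pselect (exists2 z', Z z' & chi z' = i);
    [exists z' | exists 0; split=> // /h].
have /choice[rep repP] (p : nat * nat) : exists a, (exists a', col p.1 a' = p.2) -> col p.1 a = p.2.
  by have [[a' h]|h] := pselect (exists a', col p.1 a' = p.2); [exists a' | exists 0 => /h].
pose shift (p : nat * nat * seq nat) : A :=
  zr p.1.1 + lincomb p.1.2 (fun j => rep (p.1.2, nth 0%N p.2 j)).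
pose F i : set A := if unpickle i is Some p
  then [set z | small_image p.1.2 (del p.1.2) (z - shift p)] else set0.
have Fnd i : nowhere_dense_in (F i).
  rewrite /F; case: unpickle => [p|].
    apply: nowhere_dense_translate; last by have [] := delP p.1.2.
    by apply: ZD; [have [] := zrP p.1.1 | exact: lincomb_Z].
  by move=> z eps Zz eps0; exists z, 1; split; [|exact: ltr01|rewrite (d_refl dM)|move=> y _ _ []].
have [z Zz zF] := baire Fnd.
have [Zzr zrE] := zrP (chi z).
have [|n [s sE]] := chiP _ _ Zz Zzr; first by apply/esym/zrE; exists z.
pose p := (chi z, n, [seq col n (s j) | j <- iota 0 n]).
apply: (zF (pickle p)); rewrite /F pickleK /=.
pose r j := rep (n, nth 0%N p.2 j).
exists (fun j => s j - r j) => [j jn|].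
  apply: colP; have := repP (n, nth 0%N p.2 j).
  rewrite /r /= (nth_map 0%N) ?size_iota // nth_iota // add0n => -> //.
  by exists (s j).
by rewrite lincombB -sE /shift opprD addrA.
Qed.

End OpenMapping.

(** * The ideal of big coordinate values *)

Lemma uncountable_diff (A : Type) (B C : set A) :
  countable C -> ~ countable B -> ~ countable (B `\` C).
Proof.
move=> cC ncB cBC; apply: ncB.
have sub : B `<=` \bigcup_(i in [set: bool]) (if i then C else B `\` C).
  by move=> x Bx; have [Cx|nCx] := pselect (C x); [exists true | exists false].
apply: sub_countable (subset_card_le sub) _.
by apply: bigcup_countable => [|[] _]; [exact: countableP|exact: cC|exact: cBC].
Qed.

Section TraceIdeal.
Import Order.TTheory Num.Theory.
Variables (R : nzRingType) (A : lmodType R) (c : A -> A -> R) (supp : A -> seq A).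
Hypothesis cP : coordinates c supp.
Hypotheses (R_countable : countable [set: R]) (A_uncountable : ~ countable [set: A]).
Variables (K : realType) (d : A -> A -> K).
Hypothesis dM : metric_module d.

Definition trace_ideal (t : R) : Prop := exists s : seq (R * R),
  (forall p, p \in s -> big_value c p.1) /\ t = \sum_(p <- s) p.1 * p.2.

Local Notation T := trace_ideal.

Lemma trace0 : T 0. Proof. by exists [::]; rewrite big_nil. Qed.
Lemma traceD x y : T x -> T y -> T (x + y).
Proof.
move=> [s [sB ->]] [s' [s'B ->]]; exists (s ++ s'); rewrite big_cat; split=> // p.
by rewrite mem_cat => /orP[/sB|/s'B].
Qed.
Lemma traceMl r x : T x -> T (r * x).
Proof.
move=> [s [sB ->]]; exists [seq (r * p.1, p.2) | p <- s]; split.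
  by move=> _ /mapP[p /sB pB ->] /=; exact: big_value_lmul cP _ _ pB.
by rewrite big_map mulr_sumr; apply: eq_bigr => p _ /=; rewrite mulrA.
Qed.
Lemma traceMr x r : T x -> T (x * r).
Proof.
move=> [s [sB ->]]; exists [seq (p.1, p.2 * r) | p <- s]; split.
  by move=> _ /mapP[p /sB pB ->].
by rewrite big_map mulr_suml; apply: eq_bigr => p _ /=; rewrite mulrA.
Qed.
Lemma trace_big u : big_value c u -> T u.
Proof.
move=> uB; exists [:: (u, 1)]; rewrite big_seq1 mulr1; split=> // p.
by rewrite inE => /eqP->.
Qed.

Lemma trace_ind (P : R -> Prop) : P 0 -> (forall x y, P x -> P y -> P (x + y)) ->
  (forall x r, P x -> P (x * r)) -> (forall u, big_value c u -> P u) ->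
  forall t, T t -> P t.
Proof.
move=> P0 PD PM Pb t [s [sB ->]]; rewrite big_seq; elim/big_rec: _ => // p x /sB pB Px.
by apply: PD => //; apply: PM; exact: Pb.
Qed.

Lemma trace_coordinate b a : ~ small_index c b -> T (c b a).
Proof.
by move=> nb; apply: trace_big => coordB; apply: nb; exists a => nB; exact: nB.
Qed.

Lemma coord_sum_seq b (s : seq A) (F : A -> R) :
  c b (\sum_(i <- s) F i *: i) = \sum_(i <- s) F i * c b i.
Proof.
elim: s => [|i s IH]; first by rewrite !big_nil (coord0 cP).
by rewrite !big_cons (coordD cP) IH (coordZ cP).
Qed.

Lemma value_preimage u : exists al : A -> A, forall b, (exists a, c b a = u) -> c b (al b) = u.
Proof.
have /choice[al alP] b : exists a', (exists a, c b a = u) -> c b a' = u.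
  by have [[a <-]|n] := pselect (exists a, c b a = u); [exists a|exists 0].
by exists al.
Qed.

(** If [u = c_b a] where [a] has no component on the small indices, then
    [u = sum_i c_i(a) c_b(i)] and all the factors are big or zero; the index [b]
    can be chosen outside the countable set of small indices. *)
Lemma trace_idem t : T t -> exists s : seq (R * R),
  (forall p, p \in s -> T p.1 /\ T p.2) /\ t = \sum_(p <- s) p.1 * p.2.
Proof.
move: t; apply: trace_ind.
- by exists [::]; rewrite big_nil.
- move=> x y [s [sT ->]] [s' [s'T ->]]; exists (s ++ s'); rewrite big_cat; split=> // p.
  by rewrite mem_cat => /orP[/sT|/s'T].
- move=> x r [s [sT ->]]; exists [seq (p.1, p.2 * r) | p <- s]; split.
    by move=> _ /mapP[p /sT[T1 T2] ->]; split=> //; exact: traceMr.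
  by rewrite big_map mulr_suml; apply: eq_bigr => p _ /=; rewrite mulrA.
move=> u uB; have [al alP] := value_preimage u.
have ncB := uncountable_diff (small_index_countable c R_countable) uB.
have [b [b' [[[ub bs] _ _ bb'] [_ sm]]]] :=
  small_difference cP R_countable dM al [::] ncB ltr01.
set a := al b - al b' in sm.
have cba : c b a = u by rewrite (coordB cP) bb' subr0 alP.
exists [seq (c i a, c b i) | i <- supp a]; split.
  move=> _ /mapP[i _ ->] /=; split; last exact: trace_coordinate.
  have [si|nsi] := pselect (small_index c i); last exact: trace_coordinate.
  by rewrite sm //; exact: trace0.
by rewrite big_map -[LHS]cba [in LHS](coord_rep cP a) coord_sum_seq.
Qed.

(** Otherwise the coordinates at the small indices, which take countably many
    values, would determine the points of [A]. *)
Lemma trace_neq0 : exists2 t, T t & t <> 0.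
Proof.
apply: contrapT => none; apply: A_uncountable.
have [chi chiP] := small_index_coloring cP R_countable.
have zero b a : ~ small_index c b -> c b a = 0.
  by move=> /trace_coordinate Tc; apply: contrapT => n0; apply: none; exists (c b a).
apply/countable_injP; exists chi => x y _ _ xy; apply/eqP; rewrite -subr_eq0.
rewrite (coord_rep cP (x - y)) big1 // => b _; rewrite (coordB cP).
have [sb|nsb] := pselect (small_index c b); last by rewrite !zero // subrr scale0r.
by rewrite (chiP _ _ xy) // subrr scale0r.
Qed.

Lemma trace_chain (x : nat -> R) : (forall n, exists r, x n.+1 = x n * r) ->
  exists n, forall t, T t -> exists r, x n * t = x n.+1 * r.
Proof.
move=> /choice[t xS]; apply: contrapT => none.
apply: (@chase _ _ _ _ cP R_countable _ _ dM x t (fun=> set0) xS) => // n.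
have [u [uB nu]] : exists u, big_value c u /\ ~ exists r, x n * u = x n.+1 * r.
  apply: contrapT => h; apply: none; exists n; apply: trace_ind.
  - by exists 0; rewrite !mulr0.
  - by move=> a b [r e] [r' e']; exists (r + r'); rewrite !mulrDr e e'.
  - by move=> a b [r e]; exists (r * b); rewrite mulrA e mulrA.
  - by move=> u uB; apply: contrapT => nu; apply: h; exists u.
exists 1, u; split=> // -[r [_ e]]; apply: nu; exists r.
by rewrite -e mul1r.
Qed.

Lemma trace_ann (y : nat -> R) : exists n,
  forall z u, (forall k, (k < n)%N -> y k * z = 0) -> T u -> y n * (z * u) = 0.
Proof.
apply: contrapT => none.
pose Y n : set R := [set r | exists2 k, (k < n)%N & r = y k].
apply: (@chase _ _ _ _ cP R_countable _ _ dM (fun=> 1) (fun=> 1) Y) => [n|n r [k kn ->]|n].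
- by rewrite mulr1.
- by exists k; rewrite ?mulr1 // ltnW.
have [z [u [Yz uB nu]]] : exists z u, [/\ forall k, (k < n)%N -> y k * z = 0,
    big_value c u & y n * (z * u) <> 0].
  apply: contrapT => h; apply: none; exists n => z u Yz; move: u; apply: trace_ind.
  - by rewrite !mulr0.
  - by move=> a b ea eb; rewrite mulrDr mulrDr ea eb addr0.
  - by move=> a b ea; rewrite [z * _]mulrA mulrA ea mul0r.
  - by move=> u uB; apply: contrapT => nu; apply: h; exists z, u.
exists z, u; split=> // [_ [k kn ->]|[h [Yh e]]]; first exact: Yz.
by apply: nu; rewrite -[z * u]mul1r e mul1r; apply: Yh; exists n.
Qed.

Lemma lincomb_widen (k : nat -> R) n m (s : nat -> A) : (n <= m)%N ->
  lincomb k n s = lincomb k m (fun j => if (j < n)%N then s j else 0).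
Proof.
move=> nm; rewrite /lincomb (big_ord_widen m (fun j => k j *: s j)) // big_mkcond /=.
by apply: eq_bigr => j _; case: ifP => //; rewrite scaler0.
Qed.

(** The closed subgroup [Z = {a | v a = 0}] contains [k_j A], where the [k_j]
    enumerate the elements of [T] annihilated by [v].  Two points of [Z] with
    equal coordinates at the small indices differ by an element of
    [k_0 A + ... + k_(n-1) A] for some [n], so the open mapping lemma applies; a
    small difference [t (a - a')] is then such a combination, and taking its
    [b]-th coordinate yields the claim. *)
Lemma trace_coherent v : exists n (k : nat -> R),
  (forall j, T (k j) /\ v * k j = 0) /\
  forall t u, T t -> v * t = 0 -> T u ->
    exists r : nat -> R, t * u = \sum_(j < n) k j * r j.
Proof.
have /countable_injP[g gi] := R_countable.
have /choice[k kP] j : exists t, [/\ T t, v * t = 0 &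
    forall t', T t' -> v * t' = 0 -> g t' = j -> t = t'].
  have [[t [Tt vt gt]]|h] := pselect (exists t, [/\ T t, v * t = 0 & g t = j]).
    exists t; split=> // t' _ _ gt'; apply: gi; rewrite ?inE //.
    by rewrite gt gt'.
  exists 0; split=> [||t' Tt' vt' gt']; [exact: trace0 | exact: mulr0 |].
  by case: h; exists t'.
have [chi chiP] := small_index_coloring cP R_countable.
pose Z : set A := [set a | v *: a = 0].
have kZ j a : Z (k j *: a) by rewrite /Z /= scalerA; have [_ -> _] := kP j; exact: scale0r.
have [|||z z' Zz Zz' zz'|n [del del0 nP]] := @open_mapping _ _ _ _ dM Z _ _ _ k kZ chi.
- exact: scaler0.
- by move=> x y /= Zx Zy; rewrite /Z /= scalerBr Zx Zy subrr.
- move=> u l Zu ul; apply: (conv_uniq dM (conv_scale dM v ul)).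
  by apply: (@conv_ext _ _ _ _ 0%N (fun=> 0)) (conv_cst dM 0) => i _; rewrite Zu.
- rewrite (coord_rep cP (z - z')); elim/big_rec: _ => [|b w _ [n [s ->]]].
    by exists 0%N, (fun=> 0); rewrite /lincomb big_ord0.
  (* each coordinate of z - z' is in T and is annihilated by v, so it is some k j *)
  have Tb : T (c b (z - z')).
    have [sb|/trace_coordinate //] := pselect (small_index c b).
    by rewrite (coordB cP) (chiP _ _ zz') // subrr; exact: trace0.
  have vb : v * c b (z - z') = 0.
    by rewrite -(coordZ cP) scalerBr Zz Zz' subrr (coord0 cP).
  pose j := g (c b (z - z')).
  have <- : k j = c b (z - z') by have [_ _] := kP j; apply.
  exists (maxn n j.+1), (fun i => (if (i < n)%N then s i else 0) + (if i == j then b else 0)).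
  rewrite lincombD -lincomb_widen ?leq_maxl // addrC; congr (_ + _).
  have jm : (j < maxn n j.+1)%N by rewrite leq_maxr.
  rewrite /lincomb (bigD1 (Ordinal jm)) //= eqxx big1 ?addr0 // => i ij.
  by rewrite ifN ?scaler0 //; apply: contra ij => /eqP ij; apply/eqP/val_inj.
exists n, k; split=> [j|t u Tt vt]; first by have [] := kP j.
move: u; apply: trace_ind.
- by exists (fun=> 0); rewrite mulr0 big1 // => j _; rewrite mulr0.
- move=> x y [r e] [r' e']; exists (fun j => r j + r' j).
  by rewrite mulrDr e e' -big_split; apply: eq_bigr => j _; rewrite mulrDr.
- move=> x y [r e]; exists (fun j => r j * y).
  by rewrite mulrA e mulr_suml; apply: eq_bigr => j _; rewrite mulrA.
move=> u uB; have [al alP] := value_preimage u.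
have [b [b' [[ub _ _ bb'] [sm _]]]] :=
  small_difference cP R_countable dM (fun b => t *: al b) [::] uB del0.
have [|s sE] := nP _ _ sm.
  by rewrite /Z /= scalerBr !scalerA vt !scale0r subrr.
exists (fun j => c b (s j)); rewrite -(coord_sum cP) -/(lincomb k n s) -sE.
by rewrite (coordB cP) bb' subr0 (coordZ cP) alP.
Qed.

End TraceIdeal.

(** * Polish projective modules yield idempotents of finite length *)

Section FreeModule.
Variables (R : nzRingType) (I : choiceType).

Definition finsupp_pred : {pred I -> R^o} :=
  [pred f | `[< exists s : seq I, forall i, i \notin s -> f i = 0 >]].

Record finsupp := Finsupp { finsupp_fun :> I -> R^o; _ : finsupp_fun \in finsupp_pred }.

HB.instance Definition _ := [isSub for finsupp_fun].
HB.instance Definition _ := [Choice of finsupp by <:].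

Fact finsupp_submod_closed : submod_closed finsupp_pred.
Proof.
split; first by apply/asboolP; exists [::].
move=> a f g /asboolP[s fs] /asboolP[s' gs]; apply/asboolP; exists (s ++ s') => i.
by rewrite mem_cat negb_or => /andP[/fs fi /gs gi]; rewrite !fctE fi gi scaler0 addr0.
Qed.
HB.instance Definition _ :=
  GRing.isSubmodClosed.Build R (I -> R^o) finsupp_pred finsupp_submod_closed.
HB.instance Definition _ := [SubChoice_isSubLmodule of finsupp by <:].

Lemma finsupp_support (f : finsupp) :
  exists s : seq I, uniq s /\ forall i, i \notin s -> f i = 0.
Proof.
have /asboolP[s fs] := valP f; exists (undup s); split; first exact: undup_uniq.
by move=> i; rewrite mem_undup; exact: fs.
Qed.

Definition support_seq (f : finsupp) : seq I := projT1 (cid (finsupp_support f)).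
Lemma support_uniq f : uniq (support_seq f).
Proof. by rewrite /support_seq; case: cid => s [us fs]. Qed.
Lemma support_out (f : finsupp) i : i \notin support_seq f -> f i = 0.
Proof. by rewrite /support_seq; case: cid => s [us fs] /=; exact: fs. Qed.
End FreeModule.

Lemma sum_support (R : nzRingType) (I : choiceType) (P : lmodType R) (f : I -> R)
    (v : I -> P) (s s' : seq I) : uniq s -> uniq s' ->
  (forall i, i \notin s -> f i = 0) -> (forall i, i \notin s' -> f i = 0) ->
  \sum_(i <- s) f i *: v i = \sum_(i <- s') f i *: v i.
Proof.
move=> us us' fs fs'.
have nz t : \sum_(i <- t) f i *: v i = \sum_(i <- [seq i <- t | f i != 0]) f i *: v i.
  rewrite (bigID (fun i => f i != 0)) /= [X in _ + X]big1 ?addr0 ?big_filter // => i.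
  by rewrite negbK => /eqP->; rewrite scale0r.
rewrite nz [RHS]nz; apply/perm_big/uniq_perm; rewrite ?filter_uniq // => i.
rewrite !mem_filter; have [//|fi] := eqVneq (f i) 0; rewrite /=.
by apply/idP/idP => _; [apply: contraNT fi => /fs' ->|apply: contraNT fi => /fs ->].
Qed.

Section DualBasis.
Variables (R : nzRingType) (P : lmodType R).

(** The canonical projection onto [P] of the free module on the set [P]. *)
Definition combination (f : finsupp R P) : P := \sum_(i <- support_seq f) f i *: i.

Lemma combinationE (f : finsupp R P) (s : seq P) : uniq s ->
  (forall i, i \notin s -> f i = 0) -> combination f = \sum_(i <- s) f i *: i.
Proof.
move=> us fs; apply: sum_support => //; [exact: support_uniq | exact: support_out].
Qed.

Fact combination_is_linear : linear combination.
Proof.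
move=> a f g; pose s := undup (support_seq f ++ support_seq g).
have sf i : i \notin s -> f i = 0.
  by rewrite mem_undup mem_cat negb_or => /andP[/support_out].
have sg i : i \notin s -> g i = 0.
  by rewrite mem_undup mem_cat negb_or => /andP[_ /support_out].
have us : uniq s by exact: undup_uniq.
rewrite (combinationE us sf) (combinationE us sg) (combinationE us) => [|i si].
  rewrite scaler_sumr -big_split; apply: eq_bigr => i _ /=.
  by rewrite scalerDl scalerA.
by rewrite /= !fctE sf ?sg // scaler0 addr0.
Qed.
HB.instance Definition _ :=
  GRing.isLinear.Build R (finsupp R P) P _ combination combination_is_linear.

Lemma combination_surj y : exists f, combination f = y.
Proof.
have hd : (fun i => (i == y)%:R : R^o) \in @finsupp_pred R P.
  by apply/asboolP; exists [:: y] => i; rewrite inE => /negbTE ->.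
exists (Finsupp hd); rewrite (@combinationE _ [:: y]) //=.
  by rewrite big_seq1 eqxx scale1r.
by move=> i; rewrite inE => /negbTE ->.
Qed.

Lemma projective_coordinates : projective P -> exists c supp, @coordinates R P c supp.
Proof.
move=> /(_ _ _ [the {linear _ -> _} of combination]
  [the {linear _ -> _} of @idfun P] combination_surj)[h hP].
exists (fun b x => (h x : finsupp R P) b), (fun x => support_seq (h x)); split.
- by move=> b r x y; rewrite linearP.
- by move=> b x; exact: support_out.
- by move=> x; rewrite -[LHS](hP x).
Qed.

End DualBasis.

Section PolishMetric.
Import Order.TTheory Num.Theory.
Variables (K : realType) (R : nzRingType) (A : topologicalModule R).

Lemma polish_metric : polish K A ->
  exists d : topMod_lmod A -> topMod_lmod A -> K, metric_module d.
Proof.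
move=> [[S Sc Sd] [d [[d_eq d_sym d_tri] d_nbhs d_cpl]]].
exists d.
have ball (x : A) e : 0 < e -> nbhs x [set y | d x y < e].
  by move=> e0; apply/d_nbhs; exists e.
split.
- by move=> x; apply/d_eq.
- by move=> x y /d_eq.
- exact: d_sym.
- exact: d_tri.
- move=> u /d_cpl[l ul]; exists l => e /(ball l)/ul [N _ NP].
  by exists N => n Nn; exact: NP.
- move=> x y e /(ball (x + y)) /(@add_continuous A (x, y)) [[U V] /= [nU nV] UV].
  have /d_nbhs[e1 e10 e1U] := nU; have /d_nbhs[e2 e20 e2V] := nV.
  exists (Num.min e1 e2); first by rewrite lt_min e10.
  move=> x' y'; rewrite !lt_min => /andP[x1 _] /andP[_ y2].
  by apply: (UV (x', y')); split; [exact: e1U | exact: e2V].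
- move=> r x e /(ball (r *: x)).
  move=> /(@topMod_scale_continuous R A (r, x)) [[U V] /= [nU nV] UV].
  have /d_nbhs[e2 e20 e2V] := nV; exists e2 => // x' /e2V Vx'.
  by apply: (UV (r, x')); split=> //=; exact: nbhs_singleton nU.
- have /countable_injP[g gi] := Sc.
  have /choice[D DP] n : exists a : A, forall a', S a' -> g a' = n -> a = a'.
    have [[a [Sa ga]]|h] := pselect (exists a, S a /\ g a = n).
      by exists a => a' Sa' ga'; apply: gi; rewrite ?inE // ga.
    by exists 0 => a' Sa' ga'; case: h; exists a'.
  exists D => x e e0.
  have [|y [yB Sy]] := Sd [set y | d x y < e]^° _ (open_interior _).
    by exists x; exact: ball.
  by exists (g y); rewrite (DP (g y) y Sy erefl); exact: (interior_subset yB).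
Qed.

End PolishMetric.

Lemma polish_finite_length (K : realType) (R : nzRingType) (A : topologicalModule R) :
  countable [set: R] -> polish K A -> ~ countable [set: A] ->
  projective (topMod_lmod A) ->
  exists e : nzidempotent R, irreducible_idempotent (e : R) /\ finite_length (Re e).
Proof.
move=> Rc /polish_metric[d dM] Au /projective_coordinates[c [supp cP]].
have [e [ei el fe]] := finite_length_idempotent (trace0 c) (@traceD _ _ c)
  (traceMl cP) (@traceMr _ _ c) (trace_idem cP Rc dM) (trace_chain cP Rc dM)
  (trace_ann cP Rc dM) (trace_coherent cP Rc dM) (trace_neq0 cP Rc Au).
have [ee e0 _] := ei.
exists (NzIdempotent ee e0); split=> //.
exact: (@filtered_finite_length _ (NzIdempotent ee e0)).
Qed.

(** * Artinian and noetherian modules *)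

Section Modules.
Variable S : nzRingType.

Definition fin_gen (M : lmodType S) (N : {pred M}) : Prop :=
  exists (n : nat) (g : nat -> M), (forall j, g j \in N) /\
    forall x, x \in N -> exists c : nat -> S, x = \sum_(j < n) c j *: g j.

Definition noetherian (M : lmodType S) : Prop :=
  forall N : {pred M}, submodule N -> fin_gen N.

Section Submodule.
Variables (M : lmodType S) (N : {pred M}).
Hypothesis sN : submodule N.
Lemma submod0 : 0 \in N. Proof. by have [] := sN. Qed.
Lemma submodD x y : x \in N -> y \in N -> x + y \in N.
Proof. by move=> Nx Ny; have [_ /(_ 1 _ _ Nx Ny)] := sN; rewrite scale1r. Qed.
Lemma submodZ a x : x \in N -> a *: x \in N.
Proof. by move=> Nx; have [N0 /(_ a _ _ Nx N0)] := sN; rewrite addr0. Qed.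
Lemma submodB x y : x \in N -> y \in N -> x - y \in N.
Proof. by move=> Nx Ny; rewrite -scaleN1r; apply: submodD => //; exact: submodZ. Qed.
End Submodule.

Lemma submodule_sum (M : lmodType S) (N P : {pred M}) : submodule N -> submodule P ->
  submodule [pred z | `[< exists x y, [/\ x \in N, y \in P & z = x + y] >]].
Proof.
move=> sN sP; split.
  by apply/asboolP; exists 0, 0; rewrite addr0 !submod0.
move=> a u v /asboolP[x [y [Nx Py ->]]] /asboolP[x' [y' [Nx' Py' ->]]].
apply/asboolP; exists (a *: x + x'), (a *: y + y'); split.
- by apply: submodD => //; exact: submodZ.
- by apply: submodD => //; exact: submodZ.
- by rewrite scalerDr addrACA.
Qed.

Lemma submodule_meet (M : lmodType S) (N P : {pred M}) : submodule N -> submodule P ->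
  submodule [predI N & P].
Proof.
move=> sN sP; split; first by rewrite !inE !submod0.
move=> a u v /andP[Nu Pu] /andP[Nv Pv]; apply/andP.
by split; apply: submodD => //; exact: submodZ.
Qed.

Lemma submodule_line (M : lmodType S) (z : M) : submodule [pred y | `[< exists a, y = a *: z >]].
Proof.
split; first by apply/asboolP; exists 0; rewrite scale0r.
move=> a u v /asboolP[b ->] /asboolP[b' ->]; apply/asboolP.
by exists (a * b + b'); rewrite scalerDl scalerA.
Qed.

(** Maximality of [N] in [P] gives [N + L = P]. *)
Lemma maximal_fill (M : lmodType S) (N P L : {pred M}) : submodule N -> submodule P ->
  submodule L -> maximal_submodule N P -> {subset L <= P} -> ~ {subset L <= N} ->
  forall x, x \in P -> exists y z, [/\ y \in N, z \in L & x = y + z].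
Proof.
move=> sN sP sL [NP _ Nmax] LP nLN x Px.
have [y Ny|y /asboolP[u [v [Nu Lv ->]]]|NE|NE] := Nmax _ (submodule_sum sN sL).
- by apply/asboolP; exists y, 0; rewrite addr0 Ny submod0.
- by apply: submodD => //; [exact: NP | exact: LP].
- case: nLN => y Ly; rewrite -NE; apply/asboolP; exists 0, y.
  by rewrite add0r submod0.
- by move: Px; rewrite -NE => /asboolP[y [z yz]]; exists y, z.
Qed.

(** Along a composition series [N_i], the sets [L_m] meet [N_i] in a sequence
    that is eventually constant, by induction on [i]. *)
Lemma finite_length_artinian (M : lmodType S) : finite_length M -> artinian M.
Proof.
move=> [n [N [Nsub N0 Nn Nmax]]] L Lsub Ldec.
have Lle i j : (i <= j)%N -> {subset L j <= L i}.
  move=> /subnKC <-; elim: (j - i)%N => [|k IH] x; first by rewrite addn0.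
  by rewrite addnS => /Ldec/IH.
have key i : (i <= n)%N -> exists m0, forall m, (m0 <= m)%N ->
    forall x, x \in N i -> x \in L m0 -> x \in L m.
  elim: i => [_|i IH lin].
    by exists 0%N => m _ x; rewrite N0 => /eqP-> _; exact: submod0.
  have [m0 m0P] := IH (ltnW lin); have NN := Nmax i lin.
  have [[m1 [m01 sub]]|none] := pselect (exists m1, (m0 <= m1)%N /\
      forall x, x \in L m1 -> x \in N i.+1 -> x \in N i).
    exists m1 => m m1m x Nx Lx; apply: (m0P m (leq_trans m01 m1m)).
      exact: sub.
    exact: Lle m01 _ Lx.
  exists m0 => m m0m x Nx Lx.
  have [|||y [z [Ny Lz xE]]] := @maximal_fill _ _ _ [predI L m & N i.+1]
      (Nsub i) (Nsub i.+1) _ NN _ _ x Nx.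
  - exact: submodule_meet.
  - by move=> z /andP[].
  - move=> sub; apply: none; exists m; split=> // z Lz Nz; apply: sub.
    exact/andP.
  have /andP[Lmz _] := Lz; rewrite xE; apply: submodD => //.
  apply: (m0P m m0m) => //; have -> : y = x - z by rewrite xE addrK.
  by apply: submodB => //; exact: Lle m0m _ Lmz.
have [m0 m0P] := key n (leqnn n); exists m0 => m m0m x.
by apply/idP/idP => [/(Lle _ _ m0m)//|]; apply: m0P => //; rewrite Nn.
Qed.

Lemma finite_length_noetherian (M : lmodType S) : finite_length M -> noetherian M.
Proof.
move=> [n [N [Nsub N0 Nn Nmax]]] L Lsub.
suff key i : (i <= n)%N -> fin_gen [predI L & N i].
  have [m [g [gL gP]]] := key n (leqnn n); exists m, g; split.
    by move=> j; have /andP[] := gL j.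
  by move=> x Lx; apply: gP; rewrite inE Lx Nn.
elim: i => [_|i IH lin].
  exists 0%N, (fun=> 0); split=> [j|x /andP[_]]; first by rewrite !inE !submod0.
  by rewrite N0 => /eqP->; exists (fun=> 0); rewrite big_ord0.
have [m [g [gL gP]]] := IH (ltnW lin); have NN := Nmax i lin.
have [NiS _ _] := NN.
have [sub|] := pselect (forall x, x \in L -> x \in N i.+1 -> x \in N i).
  exists m, g; split=> [j|x /andP[Lx Nx]].
    by have /andP[Lg Ng] := gL j; rewrite inE Lg NiS.
  by apply: gP; rewrite inE Lx sub.
move=> /existsNP[z /not_implyP[Lz /not_implyP[Nz nz]]].
exists m.+1, (fun j => if (j < m)%N then g j else z); split=> [j|x /andP[Lx Nx]].
  case: ifP => _; last by rewrite inE Lz.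
  by have /andP[Lg Ng] := gL j; rewrite inE Lg NiS.
have [||y [w [Ny /asboolP[a wE] xE]]] := @maximal_fill _ _ _ _
    (Nsub i) (Nsub i.+1) (submodule_line z) NN _ _ x Nx.
- by move=> w /asboolP[a ->]; exact: submodZ.
- by move=> sub; apply: nz; apply: sub; apply/asboolP; exists 1; rewrite scale1r.
have [|c yE] := gP y.
  rewrite inE Ny andbT; have -> : y = x - w by rewrite xE addrK.
  by apply: submodB => //; rewrite wE; exact: submodZ.
exists (fun j => if (j < m)%N then c j else a).
rewrite big_ord_recr /= ltnn xE wE yE; congr (_ + _).
by apply: eq_bigr => j _; rewrite /= ltn_ord.
Qed.

Lemma noetherian_inj (M P : lmodType S) (f : {linear M -> P}) : injective f ->
  noetherian P -> noetherian M.
Proof.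
move=> fi nP N sN.
pose fN : {pred P} := [pred y | `[< exists2 x, x \in N & y = f x >]].
have sfN : submodule fN.
  split; first by apply/asboolP; exists 0; [exact: submod0 | rewrite linear0].
  move=> a _ _ /asboolP[x Nx ->] /asboolP[y Ny ->]; apply/asboolP.
  by exists (a *: x + y); [apply: submodD => //; exact: submodZ | rewrite linearP].
have [n [g [gN gP]]] := nP _ sfN.
have /choice[h hP] j : exists x, x \in N /\ g j = f x.
  by have /asboolP[x] := gN j; exists x.
exists n, h; split=> [j|x Nx]; first by have [] := hP j.
have [|c cE] := gP (f x); first by apply/asboolP; exists x.
exists c; apply: fi; rewrite cE linear_sum; apply: eq_bigr => j _.
by rewrite linearZ; have [_ ->] := hP j.
Qed.

(** Induction on the number of coordinates that may be nonzero: the values of the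
    last one form an ideal, whose finitely many generators are lifted. *)
Lemma noetherian_row : noetherian (S^o : lmodType S) -> forall n, noetherian ('rV[S]_n).
Proof.
move=> nS n N sN.
pose tail k : {pred 'rV[S]_n} := [pred x : 'rV[S]_n |
  `[< x \in N /\ forall i : 'I_n, (k <= i)%N -> x 0 i = 0 >]].
suff key k : (k <= n)%N -> fin_gen (tail k).
  have [m [g [gN gP]]] := key n (leqnn n); exists m, g; split=> [j|x Nx].
    by have /asboolP[] := gN j.
  by apply: gP; apply/asboolP; split=> // i; rewrite leqNgt ltn_ord.
elim: k => [_|k IH kn].
  exists 0%N, (fun=> 0); split=> [j|x /asboolP[_ x0]].
    by apply/asboolP; split=> [|i _]; [exact: submod0 | rewrite mxE].
  exists (fun=> 0); rewrite big_ord0; apply/rowP => i.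
  by rewrite x0 // mxE.
have [m [g [gN gP]]] := IH (ltnW kn); pose ik := Ordinal kn.
pose I : {pred S^o} := [pred a : S^o | `[< exists2 x, x \in tail k.+1 & a = x 0 ik >]].
have sT : submodule (tail k.+1).
  split; first by apply/asboolP; split=> [|i _]; [exact: submod0 | rewrite mxE].
  move=> a u v /asboolP[Nu u0] /asboolP[Nv v0]; apply/asboolP; split.
    by apply: submodD => //; exact: submodZ.
  by move=> i ki; rewrite !mxE u0 // v0 // mulr0 addr0.
have sI : submodule I.
  split; first by apply/asboolP; exists 0; [exact: submod0 | rewrite mxE].
  move=> a _ _ /asboolP[u Tu ->] /asboolP[v Tv ->]; apply/asboolP.
  by exists (a *: u + v); [apply: submodD => //; exact: submodZ | rewrite !mxE].
have [p [h [hI hP]]] := nS _ sI.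
have /choice[u uP] j : exists u, u \in tail k.+1 /\ h j = u 0 ik.
  by have /asboolP[u] := hI j; exists u.
exists (m + p)%N, (fun j => if (j < m)%N then g j else u (j - m)%N); split=> [j|x Tx].
  case: ifP => _; last by have [] := uP (j - m)%N.
  have /asboolP[Ng g0] := gN j; apply/asboolP; split=> // i ki.
  by apply: g0; exact: ltnW.
have [|c cE] := hP (x 0 ik); first by apply/asboolP; exists x.
pose y := x - \sum_(j < p) c j *: u j.
have Ty : y \in tail k.+1.
  apply: submodB => //; elim/big_rec: _ => [|j z _ Tz]; first exact: submod0.
  by apply: submodD => //; apply: submodZ => //; have [] := uP j.
have yk : y 0 ik = 0.
  rewrite !mxE cE summxE -sumrB big1 // => j _.
  by rewrite mxE; have [_ ->] := uP j; rewrite subrr.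
have [|c' yE] := gP y.
  have /asboolP[Ny y0] := Ty; apply/asboolP; split=> // i.
  rewrite leq_eqVlt => /predU1P[ki|]; last exact: y0.
  by have -> : i = ik by apply/val_inj.
exists (fun j => if (j < m)%N then c' j else c (j - m)%N).
rewrite big_split_ord /= -[x](subrK (\sum_(j < p) c j *: u j)) -/y yE.
congr (_ + _); apply: eq_bigr => j _; first by rewrite /= ltn_ord.
by rewrite ltnNge leq_addr /= addKn.
Qed.

Definition row_comb (M : lmodType S) n (g : nat -> M) (x : 'rV[S]_n) : M :=
  \sum_(j < n) x 0 j *: g j.

Fact row_comb_is_linear (M : lmodType S) n (g : nat -> M) : linear (@row_comb M n g).
Proof.
move=> a x y; rewrite /row_comb scaler_sumr -big_split; apply: eq_bigr => j _ /=.
by rewrite !mxE scalerDl scalerA.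
Qed.
HB.instance Definition _ (M : lmodType S) n (g : nat -> M) :=
  GRing.isLinear.Build S 'rV[S]_n M _ (row_comb g) (row_comb_is_linear g).

Lemma row_combE (M : lmodType S) n (g : nat -> M) (c : nat -> S) :
  row_comb g (\row_(j < n) c j) = \sum_(j < n) c j *: g j.
Proof. by apply: eq_bigr => j _; rewrite mxE. Qed.

Lemma noetherian_finitely_presented (M : lmodType S) :
  noetherian (S^o : lmodType S) -> noetherian M -> finitely_presented M.
Proof.
move=> nS nM.
have [|n [p [_ pP]]] := nM predT; first by split.
pose ker : {pred 'rV[S]_n} := [pred x | row_comb p x == 0].
have [|m [g [gK gP]]] := noetherian_row nS (N := ker).
  split=> [|a x y /eqP x0 /eqP y0]; apply/eqP; first exact: linear0.
  by rewrite linearP /= x0 y0 scaler0 addr0.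
exists m, n, [the {linear _ -> _} of row_comb g], [the {linear _ -> _} of row_comb p].
split=> [y|x].
  by have [//|c ->] := pP y; exists (\row_(j < n) c j); exact: row_combE.
split=> [x0|[z <-]].
  have [|c ->] := gP x; first exact/eqP.
  by exists (\row_(j < m) c j); exact: row_combE.
change (row_comb p (\sum_(j < m) z 0 j *: g j) = 0).
rewrite linear_sum big1 // => j _.
by rewrite linearZ /=; have /eqP -> := gK j; rewrite scaler0.
Qed.

End Modules.

(** * Countable powers of local rings *)

Section LocalRing.
Variable S : nzRingType.
Hypothesis S_local : nil_or_unit (1 : S).

Definition nilpotent (s : S) : Prop := exists n, s ^+ n.+1 = 0.

Lemma local_cases s : nilpotent s \/ exists s', s * s' = 1 /\ s' * s = 1.
Proof.
have [|[n sn]|[s' [_ ss' s's]]] := S_local (s := s); first by rewrite mul1r mulr1.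
  by left; exists n.
by right; exists s'.
Qed.

Lemma nilpotent_right_inv s w : nilpotent s -> s * w <> 1.
Proof.
move=> [n sn] sw; have := nil_right_inv (mulr1 s) sn sw.
by apply/eqP; exact: oner_neq0.
Qed.

Lemma nilpotentMr s t : nilpotent s -> nilpotent (s * t).
Proof.
move=> sn; have [//|[w [e _]]] := local_cases (s * t).
by case: (nilpotent_right_inv (w := t * w) sn); rewrite mulrA.
Qed.

Lemma nilpotent_unit1B s : nilpotent s -> exists w, (1 - s) * w = 1.
Proof.
move=> [n sn]; exists (\sum_(i < n.+1) s ^+ i).
by have := subrX1 s n.+1; rewrite sn sub0r -[s - 1]opprB mulNr => /oppr_inj.
Qed.

Lemma nilpotentD s t : nilpotent s -> nilpotent t -> nilpotent (s + t).
Proof.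
move=> sn tn; have [//|[w [e _]]] := local_cases (s + t).
have [w' e'] := nilpotent_unit1B (nilpotentMr w sn).
case: (nilpotent_right_inv (w := w * w') tn); rewrite mulrA -e'; congr (_ * _).
by rewrite -e mulrDl addrC addKr.
Qed.

Lemma nilpotent0 : nilpotent 0. Proof. by exists 0%N; rewrite expr1. Qed.

Local Notation V := (nat -> S^o).

(** Asking for dual functionals, instead of independence modulo the radical,
    avoids linear algebra over the residue division ring, and independence
    is immediate. *)
Definition split_set (B : set V) : Prop := forall s : seq V, uniq s ->
  (forall x, x \in s -> B x) -> exists phi : V -> V -> S,
  (forall b a x y, phi b (a *: x + y) = a * phi b x + phi b y) /\
  forall b b', b \in s -> b' \in s -> phi b b' = (b == b')%:R.

Lemma split_set_max : exists B, split_set B /\ forall B', B `<` B' -> ~ split_set B'.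
Proof.
apply: Zorn_bigcup => F Fsplit Ftot s us sF.
have [->|] := eqVneq s [::]; first by exists (fun _ _ => 0); split=> // *; rewrite mulr0 addr0.
case: s us sF => // x0 s us sF _.
suff [X FX sX] : exists2 X, F X & forall x, x \in x0 :: s -> X x.
  exact: Fsplit FX _ us sX.
elim: s x0 {us} sF => [|x1 s IH] x0 sF.
  have [X FX Xx] := sF x0 (mem_head _ _).
  by exists X => // x; rewrite inE => /eqP->.
have [|X FX sX] := IH x1; first by move=> x xs; apply: sF; rewrite inE xs orbT.
have [Y FY Yx] := sF x0 (mem_head _ _).
have [XY|YX] := Ftot _ _ FX FY.
  by exists Y => // x; rewrite inE => /predU1P[->//|/sX/XY].
by exists X => // x; rewrite inE => /predU1P[->|/sX//]; exact: YX.
Qed.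

Section MaximalSplit.
Variable B : set V.
Hypotheses (B_split : split_set B) (B_max : forall B', B `<` B' -> ~ split_set B').

Definition spanned (y : V) : Prop := exists (s : seq V) (c : V -> S),
  [/\ uniq s, forall x, x \in s -> B x, forall x, x \notin s -> c x = 0 &
    y = \sum_(x <- s) c x *: x].

Lemma spanned0 : spanned 0.
Proof. by exists [::], (fun=> 0); rewrite big_nil. Qed.

Lemma spannedZ a y : spanned y -> spanned (a *: y).
Proof.
move=> [s [c [us sB c0 ->]]]; exists s, (fun x => a * c x); split=> //.
  by move=> x /c0->; rewrite mulr0.
by rewrite scaler_sumr; apply: eq_bigr => x _; rewrite scalerA.
Qed.

Lemma spannedD y z : spanned y -> spanned z -> spanned (y + z).
Proof.
move=> [s [c [us sB c0 ->]]] [s' [c' [us' s'B c'0 ->]]].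
pose t := undup (s ++ s').
have ut : uniq t by exact: undup_uniq.
have ct x : x \notin t -> c x = 0.
  by rewrite mem_undup mem_cat negb_or => /andP[/c0].
have c't x : x \notin t -> c' x = 0.
  by rewrite mem_undup mem_cat negb_or => /andP[_ /c'0].
exists t, (fun x => c x + c' x); split=> //.
- by move=> x; rewrite mem_undup mem_cat => /orP[/sB|/s'B].
- by move=> x xt; rewrite ct // c't // addr0.
rewrite (sum_support _ us ut c0 ct) (sum_support _ us' ut c'0 c't) -big_split.
by apply: eq_bigr => x _; rewrite scalerDl.
Qed.

Lemma spanned_base x : B x -> spanned x.
Proof.
move=> Bx; exists [:: x], (fun y => (y == x)%:R); split=> //.
- by move=> y; rewrite inE => /eqP->.
- by move=> y; rewrite inE => /negbTE ->.
- by rewrite big_seq1 eqxx scale1r.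
Qed.

(** Remove from [x] its components along a finite subset.  If a coordinate of the
    rest is a unit, then it normalizes to a functional that is dual to [x], and
    [B] could be enlarged by [x]. *)
Lemma spanned_mod_radical x : exists w, spanned w /\ forall n, nilpotent (x n - w n).
Proof.
have [Bx|nBx] := pselect (B x).
  by exists x; split=> [|n]; [exact: spanned_base | rewrite subrr; exact: nilpotent0].
apply: contrapT => none.
apply: (B_max (B' := B `|` [set x])).
  split=> [y By|sub]; [by left | by apply: nBx; apply: sub; right].
move=> s us sB.
pose s' := rem x s.
have us' : uniq s' by exact: rem_uniq.
have s'B y : y \in s' -> B y.
  by rewrite mem_rem_uniq // inE => /andP[/eqP yx /sB[]].
have [phi [phi_lin phi_dual]] := B_split us' s'B.
pose res y : V := y - \sum_(b <- s') phi b y *: b.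
have res_lin a y z : res (a *: y + z) = a *: res y + res z.
  rewrite /res scalerBr addrACA; congr (_ + _).
  rewrite -opprD scaler_sumr -big_split; congr (- _); apply: eq_bigr => b _ /=.
  by rewrite phi_lin scalerDl scalerA.
have res0 b : b \in s' -> res b = 0.
  move=> bs; apply/eqP; rewrite subr_eq0 eq_sym (big_rem b) //= phi_dual // eqxx scale1r.
  rewrite big_seq big1 ?addr0 // => b' ; rewrite mem_rem_uniq // inE => /andP[bb' b's].
  by rewrite phi_dual // (negbTE bb') scale0r.
have [n [w [wx xw]]] : exists n w, res x n * w = 1 /\ w * res x n = 1.
  apply: contrapT => h; apply: none.
  exists (\sum_(b <- s') phi b x *: b); split=> [|n].
    exists s', (fun b => if b \in s' then phi b x else 0); split=> //.
      by move=> b /negbTE ->.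
    by rewrite big_seq [RHS]big_seq; apply: eq_bigr => b ->.
  have [//|[w wP]] := local_cases (res x n).
  by case: h; exists n, w.
have [psi [psi_lin psix psi0]] : exists psi : V -> S,
    [/\ forall a y z, psi (a *: y + z) = a * psi y + psi z, psi x = 1 &
      forall b, b \in s' -> psi b = 0].
  exists (fun y => (res y n : S) * w); split=> [a y z||b /res0 ->] //; last exact: mul0r.
  by rewrite res_lin !fctE [_ * w]mulrDl; congr (_ + _); exact/esym/mulrA.
exists (fun b y => if b == x then psi y else phi b y - psi y * phi b x); split.
  move=> b a y z; case: ifP => _; first exact: psi_lin.
  by rewrite phi_lin psi_lin mulrDl mulrBr opprD addrACA !mulrA.
have ss' b : b \in s -> b != x -> b \in s'.
  by move=> bs bx; rewrite mem_rem_uniq // inE bx.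
move=> b b' bs b's; case: eqVneq => [->|bx].
  have [<-|xb'] := eqVneq x b'; first exact: psix.
  by apply: psi0; apply: ss' => //; rewrite eq_sym.
have [->|b'x] := eqVneq b' x.
  by rewrite psix mul1r subrr (negbTE bx).
by rewrite psi0 ?ss' // mul0r subr0 phi_dual ?ss'.
Qed.

Hypothesis radical_fg : exists n (g : nat -> S), (forall j, nilpotent (g j)) /\
  forall s, nilpotent s -> exists r : nat -> S, s = \sum_(j < n) g j * r j.
Hypothesis radical_nil : exists n, forall j : nat -> S, (forall i, nilpotent (j i)) ->
  \prod_(i < n) j i = 0.

(** Since the radical is generated by [g_0, ..., g_(n-1)] as a right ideal, the
    sequences with values in it are the combinations of the [g_j] with arbitrary
    sequences as coefficients; iterating the previous lemma, the error lies in
    higher and higher powers of the radical. *)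
Lemma spanned_all x : spanned x.
Proof.
have [n [g [gJ gP]]] := radical_fg.
have gV (y : V) : (forall k, nilpotent (y k)) ->
    exists z : nat -> V, y = \sum_(j < n) g j *: z j.
  move=> yJ; have /choice[r rP] k := gP _ (yJ k).
  exists (fun j k => r k j); apply/funext => k; rewrite rP.
  by elim/big_rec2: _ => [//|j u v _ ->]; rewrite !fctE.
(* Jm m y: y is a combination of products of m of the generators g j *)
pose fix Jm m (y : V) {struct m} : Prop := if m is m'.+1 then
  exists z : nat -> V, (forall j, Jm m' (z j)) /\ y = \sum_(j < n) g j *: z j else True.
have approx m : forall y, exists w, spanned w /\ Jm m (y - w).
  elim: m => [|m IH] y; first by exists 0; split=> //; exact: spanned0.
  have [w [sw /gV[z zE]]] := spanned_mod_radical y.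
  have /choice[v vP] j := IH (z j).
  exists (w + \sum_(j < n) g j *: v j); split.
    apply: spannedD => //; elim/big_rec: _ => [|j u _ su]; first exact: spanned0.
    by apply: spannedD => //; apply: spannedZ; have [] := vP j.
  exists (fun j => z j - v j); split=> [j|]; first by have [] := vP j.
  rewrite opprD addrA -[y - w]/((fun k => y k - w k) : V) zE -sumrB.
  by apply: eq_bigr => j _; rewrite scalerBr.
have [N NP] := radical_nil.
have Jkill m (js : seq S) y : (forall j, j \in js -> nilpotent j) -> (size js + m = N)%N ->
    Jm m y -> (\prod_(j <- js) j) *: y = 0.
  elim: m js y => [|m IH] js y jsJ sz; last first.
    move=> [z [zJ ->]]; rewrite scaler_sumr big1 // => j _.
    have := IH (rcons js (g j)) (z j); rewrite big_rcons scalerA; apply.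
    - by move=> k; rewrite mem_rcons inE => /predU1P[->|/jsJ].
    - by rewrite size_rcons addSnnS.
    - exact: zJ.
  move=> _; rewrite (big_nth 0) big_mkord.
  have := NP (fun i => if (i < size js)%N then js`_i else 0).
  rewrite addn0 in sz; rewrite sz => h.
  have -> : \prod_(i < N) js`_i = \prod_(i < N) (if (i < N)%N then js`_i else 0).
    by apply: eq_bigr => i _; rewrite ltn_ord.
  rewrite h ?scale0r // => i; case: ifP => iN; last exact: nilpotent0.
  by apply: jsJ; rewrite mem_nth // sz.
have [w [sw wJ]] := approx N x.
have := Jkill N [::] (x - w) (fun j h => False_ind _ (elimF idP (in_nil j) h)) (add0n N) wJ.
by rewrite big_nil scale1r => /eqP; rewrite subr_eq0 => /eqP->.
Qed.

Lemma split_basis : is_basis (B : set (V : lmodType S)).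
Proof.
split=> [s c us sB s0 b bs|y]; last first.
  by have [s [c [_ sB _ ->]]] := spanned_all y; exists s, c.
have [phi [phi_lin phi_dual]] := B_split us sB.
have phi0 : phi b 0 = 0.
  by have := phi_lin b (-1) 0 0; rewrite scaler0 addr0 mulN1r addNr.
have phi_sum t : phi b (\sum_(x <- t) c x *: x) = \sum_(x <- t) c x * phi b x.
  elim: t => [|x t IH]; first by rewrite !big_nil.
  by rewrite !big_cons phi_lin IH.
have := phi_sum s; rewrite s0 phi0 (big_rem b) //= phi_dual // eqxx mulr1.
rewrite big_seq big1 ?addr0 // => b'; rewrite mem_rem_uniq // inE => /andP[bb' b's].
by rewrite phi_dual // eq_sym (negbTE bb') mulr0.
Qed.

End MaximalSplit.

End LocalRing.

(** * Corner rings of finite length *)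

Lemma artinian_inj (S : nzRingType) (M P : lmodType S) (f : {linear M -> P}) :
  injective f -> artinian P -> artinian M.
Proof.
move=> fi aP N Nsub Ndec.
pose fN i : {pred P} := [pred y | `[< exists2 x, x \in N i & y = f x >]].
have fNE i x : (f x \in fN i) = (x \in N i).
  by apply/asboolP/idP => [[x' Nx' /fi->]//|Nx]; exists x.
have [||n nP] := aP fN.
- move=> i; split; first by apply/asboolP; exists 0; [exact: submod0 | rewrite linear0].
  move=> a _ _ /asboolP[x Nx ->] /asboolP[y Ny ->]; apply/asboolP.
  by exists (a *: x + y); [apply: submodD => //; exact: submodZ | rewrite linearP].
- by move=> i _ /asboolP[x /Ndec Nx ->]; apply/asboolP; exists x.
by exists n => m /nP h x; rewrite -!fNE h.
Qed.

Section Corner.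
Variables (R : nzRingType) (e : nzidempotent R).
Local Notation S := (corner e).
Local Notation ev := (idem_val e).

Lemma corner_in_Re (a : S) : (a : R) \in Re_pred e.
Proof. by have [r ->] := corner_valP a; apply/asboolP; exists (ev * r). Qed.

Definition corner_Re (a : (S^c)^o) : Re e := InRe (corner_in_Re a).

Fact corner_Re_is_linear : linear corner_Re.
Proof. by move=> a x y; apply/val_inj. Qed.
HB.instance Definition _ :=
  GRing.isLinear.Build S^c (S^c)^o (Re e) _ corner_Re corner_Re_is_linear.

Lemma corner_Re_inj : injective corner_Re.
Proof. by move=> x y /(congr1 val) /= xy; apply/val_inj. Qed.

Lemma corner_artinian : finite_length (Re e) -> right_artinian S.
Proof.
move=> /finite_length_artinian; apply: (artinian_inj (f := corner_Re)).
exact: corner_Re_inj.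
Qed.

Lemma corner_irreducible : irreducible_idempotent ev -> irreducible_idempotent (1 : S).
Proof.
move=> [_ _ eirr]; split; first by rewrite /is_idempotent mulr1.
  by apply/eqP; exact: oner_neq0.
move=> [f [g [[ff gg fg gf] f0 g0 fgE]]]; apply: eirr.
exists (f : R), (g : R); split.
- split; rewrite /is_idempotent.
  + exact: (congr1 val ff).
  + exact: (congr1 val gg).
  + exact: (congr1 val fg).
  + exact: (congr1 val gf).
- by move=> h; apply: f0; apply/val_inj.
- by move=> h; apply: g0; apply/val_inj.
- exact: (congr1 val fgE).
Qed.

(** The corner ring satisfies the descending chain condition on right ideals,
    so the earlier argument applies to it with [T] the whole ring and [1] as the
    irreducible idempotent. *)
Lemma corner_local : irreducible_idempotent ev -> right_artinian S -> nil_or_unit (1 : S).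
Proof.
move=> /corner_irreducible irr art.
apply: (@irreducible_local S (fun=> True)) => //.
  by move=> t _; exists [:: (t, 1)]; rewrite big_seq1 mulr1.
move=> x xS.
pose N n : {pred (S^c)^o} := [pred y : (S^c)^o | `[< exists r : S, (y : S) = x n * r >]].
have [||n nP] := art N.
- move=> n; split; first by apply/asboolP; exists 0; rewrite mulr0.
  move=> a _ _ /asboolP[r ->] /asboolP[s ->]; apply/asboolP.
  by exists (r * (a : S) + s); rewrite mulrDr mulrA.
- move=> n _ /asboolP[r ->]; have [s ->] := xS n; apply/asboolP.
  by exists (s * r); rewrite mulrA.
exists n => t _.
have : (x n * t : (S^c)^o) \in N n by apply/asboolP; exists t.
by rewrite -(nP n.+1 (leqnSn n)) => /asboolP.
Qed.

(** The radical moves each step of a composition series of [Re] into the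
    preceding one (Nakayama), and the corner ring acts faithfully on [Re]. *)
Lemma corner_radical_nil : nil_or_unit (1 : S) -> finite_length (Re e) ->
  exists n, forall j : nat -> S, (forall i, nilpotent (j i)) -> \prod_(i < n) j i = 0.
Proof.
move=> loc [n [N [Nsub N0 Nn Nmax]]]; exists n => j jJ.
have lower i (x : Re e) (s : S) : (i < n)%N -> nilpotent s -> x \in N i.+1 ->
    (s : S^c) *: x \in N i.
  move=> lin sn Nx; have NN := Nmax i lin; have [NS _ _] := NN.
  apply: contrapT => nsx.
  have [||y [z [Ny /asboolP[a zE] xE]]] := maximal_fill (Nsub i) (Nsub i.+1)
      (submodule_line ((s : S^c) *: x)) NN _ _ Nx.
  - by move=> z /asboolP[a ->]; do 2 apply: submodZ => //.
  - move=> sub; apply: nsx; apply: sub; apply/asboolP.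
    by exists 1; rewrite scale1r.
  have [w wE] := nilpotent_unit1B (nilpotentMr loc (a : S) sn).
  have yE : y = (1 - (s : S) * (a : S) : S^c) *: x.
    by rewrite scalerBl scale1r {1}xE zE scalerA addrK.
  apply: nsx; apply: submodZ => //.
  have -> : x = (w : S^c) *: y.
    rewrite yE scalerA; have -> : (w : S^c) * (1 - (s : S) * (a : S) : S^c) = 1 by exact: wE.
    by rewrite scale1r.
  exact: submodZ.
have descend k : (k <= n)%N -> corner_Re (\prod_(i < k) j i) \in N (n - k)%N.
  elim: k => [_|k IH kn]; first by rewrite subn0 Nn.
  rewrite big_ord_recr /=.
  have -> : corner_Re (\prod_(i < k) j i * j k) =
      (j k : S^c) *: corner_Re (\prod_(i < k) j i) by apply/val_inj.
  apply: lower => //; first by rewrite ltn_subrL (leq_ltn_trans (leq0n k) kn).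
  by rewrite subnSK //; exact: IH (ltnW kn).
have := descend n (leqnn n); rewrite subnn N0 => /eqP h.
by apply: corner_Re_inj; rewrite h linear0.
Qed.

Lemma corner_radical_fg : nil_or_unit (1 : S) -> noetherian ((S^c)^o : lmodType S^c) ->
  exists n (g : nat -> S), (forall j, nilpotent (g j)) /\
  forall s : S, nilpotent s -> exists r : nat -> S, s = \sum_(j < n) g j * r j.
Proof.
move=> loc noe.
pose J : {pred (S^c)^o} := [pred s : (S^c)^o | `[< nilpotent (s : S) >]].
have [|n [g [gJ gP]]] := noe J.
  split; first by apply/asboolP; exact: nilpotent0.
  move=> a x y /asboolP xn /asboolP yn; apply/asboolP.
  by apply: (nilpotentD loc) => //; exact: (nilpotentMr loc).
exists n, g; split=> [j|s sn]; first by have /asboolP := gJ j.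
by have [|c sE] := gP s; [exact/asboolP | exists c].
Qed.

Lemma finite_length_corner : irreducible_idempotent ev -> right_artinian S ->
  finite_length (Re e) -> left_F_ring S /\ finitely_presented (Re e).
Proof.
move=> irr art filtered; have loc := corner_local irr art.
have nRe := finite_length_noetherian filtered.
have nS : noetherian ((S^c)^o : lmodType S^c).
  by apply: noetherian_inj nRe; exact: corner_Re_inj.
split; last exact: noetherian_finitely_presented.
have [B [Bs Bmax]] := split_set_max S.
exists B; apply: (split_basis loc Bs Bmax); first exact: corner_radical_fg.
exact: corner_radical_nil.
Qed.

End Corner.

(** * The countable power of [Re] as a Polish module *)

(** Lift the vectors of the dual basis and extend by the coordinates. *)
Lemma dual_basis_projective (R : nzRingType) (P : lmodType R) (I : choiceType)
    (v : I -> P) (c : I -> P -> R) (supp : P -> seq I) :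
  (forall i r x y, c i (r *: x + y) = r * c i x + c i y) ->
  (forall x, uniq (supp x)) -> (forall i x, i \notin supp x -> c i x = 0) ->
  (forall x, x = \sum_(i <- supp x) c i x *: v i) -> projective P.
Proof.
move=> c_lin s_uniq c_supp c_rep M N g f g_surj.
have /choice[m mP] i := g_surj (f (v i)).
pose h x := \sum_(i <- supp x) c i x *: m i.
have h_lin : linear h.
  move=> a x y; pose s := undup (supp x ++ supp y).
  have us : uniq s by exact: undup_uniq.
  have sx i : i \notin s -> c i x = 0.
    by rewrite mem_undup mem_cat negb_or => /andP[/c_supp].
  have sy i : i \notin s -> c i y = 0.
    by rewrite mem_undup mem_cat negb_or => /andP[_ /c_supp].
  have sxy i : i \notin s -> c i (a *: x + y) = 0.
    by move=> si; rewrite c_lin sx // sy // mulr0 addr0.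
  rewrite /h (sum_support m (s_uniq x) us (c_supp^~ x) sx).
  rewrite (sum_support m (s_uniq y) us (c_supp^~ y) sy).
  rewrite (sum_support m (s_uniq _) us (c_supp^~ _) sxy).
  rewrite scaler_sumr -big_split; apply: eq_bigr => i _.
  by rewrite c_lin scalerDl scalerA.
pose hL := GRing.isLinear.Build R P M _ h h_lin.
exists (HB.pack_for {linear P -> M} h hL) => x /=.
rewrite [in RHS](c_rep x) /h !linear_sum; apply: eq_bigr => i _.
by rewrite !linearZ /= mP.
Qed.

Section RePower.
Variables (R : nzRingType) (e : nzidempotent R).
Local Notation S := (corner e).
Local Notation ev := (idem_val e).

Definition Re_power : Type := nat -> Re e.
HB.instance Definition _ := GRing.Zmodule.copy Re_power (nat -> Re e).

Definition agree n (x y : Re_power) : Prop := forall i, (i < n)%N -> y i = x i.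
Definition Re_power_nbhs (x : Re_power) : set_system Re_power :=
  [set U | exists n, forall y, agree n x y -> U y].

HB.instance Definition _ := hasNbhs.Build Re_power Re_power_nbhs.

Fact Re_power_filter (x : Re_power) : ProperFilter (Re_power_nbhs x).
Proof.
apply: Build_ProperFilter_ex.
  by move=> U [n nU]; exists x; exact: nU.
split; first by exists 0%N.
- move=> U V [n nU] [m mV]; exists (maxn n m) => y xy; split.
    by apply: nU => i lin; apply: xy; rewrite leq_max lin.
  by apply: mV => i lin; apply: xy; rewrite leq_max lin orbT.
- by move=> U V UV [n nU]; exists n => y /nU/UV.
Qed.

Fact Re_power_singleton (x : Re_power) (U : set Re_power) : Re_power_nbhs x U -> U x.
Proof. by move=> [n]; apply. Qed.

Fact Re_power_nbhs_nbhs (x : Re_power) (U : set Re_power) :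
  Re_power_nbhs x U -> Re_power_nbhs x (Re_power_nbhs^~ U).
Proof.
move=> [n nU]; exists n => y xy; exists n => z yz; apply: nU => i lin.
by rewrite yz // xy.
Qed.

HB.instance Definition _ := Nbhs_isNbhsTopological.Build Re_power
  Re_power_filter Re_power_singleton Re_power_nbhs_nbhs.

Fact Re_power_sub_continuous : continuous (fun x : Re_power * Re_power => x.1 - x.2).
Proof.
move=> [x y] U [n nU]; exists ([set z | agree n x z], [set z | agree n y z]).
  by split; exists n.
by move=> [x' y'] [/= xx' yy']; apply: nU => i lin; rewrite !fctE xx' // yy'.
Qed.

HB.instance Definition _ :=
  PreTopologicalNmodule_isTopologicalZmodule.Build Re_power Re_power_sub_continuous.

Fact Re_left_subproof (r : R) (x : Re e) : r * (x : R) \in Re_pred e.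
Proof. by have [s ->] := Re_valP x; apply/asboolP; exists (r * s); rewrite mulrA. Qed.

Definition Re_left (r : R) (x : Re e) : Re e := InRe (Re_left_subproof r x).
Definition Re_power_scale (r : R) (x : Re_power) : Re_power := fun n => Re_left r (x n).

Definition Re_power_module : topologicalModule R.
Proof.
refine (@TopologicalModule R Re_power Re_power_scale _ _ _ _ _).
- by move=> a b x; apply/funext => n; apply/val_inj; rewrite /= mulrA.
- by move=> x; apply/funext => n; apply/val_inj; rewrite /= mul1r.
- by move=> a x y; apply/funext => n; apply/val_inj; rewrite /= mulrDr.
- by move=> x a b; apply/funext => n; apply/val_inj; rewrite /= mulrDl.
- move=> [r x] U [n nU]; exists ([set r], [set z | agree n x z]).
    by split; [ | exists n].
  move=> [r' x'] [/= -> xx']; apply: nU => i lin.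
  by rewrite /Re_power_scale xx'.
Defined.

Lemma Re_power_uncountable : ~ countable [set: Re_power_module].
Proof.
move=> /countable_injP[f fi].
have e_in : ev \in Re_pred e by apply/asboolP; exists 1; rewrite mul1r.
pose one : Re e := InRe e_in.
have one0 : one <> 0 by move=> /(congr1 val) /=; exact: idem_neq0.
have /choice[g gP] n : exists a : Re_power, forall b : Re_power, f b = n -> a = b.
  have [[a fa]|h] := pselect (exists a : Re_power, f a = n).
    by exists a => b fb; apply: fi; rewrite ?inE // fa.
  by exists 0 => b fb; case: h; exists b.
(* diag differs at each n from the sequence g n that f sends to n *)
have [diag dE] : exists diag : Re_power, forall n, diag n = if g n n == 0 then one else 0.
  by exists (fun n => if g n n == 0 then one else 0).
have := congr1 (fun a : Re_power => a (f diag)) (gP _ diag erefl); rewrite /= dE.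
by have [g0|/eqP g0 //] := eqVneq (g (f diag) (f diag)) 0; rewrite g0 => /esym.
Qed.

Lemma Re_power_separable : countable [set: R] -> separable_space Re_power_module.
Proof.
move=> Rc; exists [set x : Re_power | exists n, forall i, (n <= i)%N -> x i = 0].
  have /countable_injP[f fi] := Rc.
  pose code (x : Re_power) n := [seq f (x i : R) | i <- iota 0 n].
  have /choice[len lenP] (x : Re_power) : exists n,
      (exists n, forall i, (n <= i)%N -> x i = 0) -> forall i, (n <= i)%N -> x i = 0.
    have [[n nP]|h] := pselect (exists n, forall i, (n <= i)%N -> x i = 0).
      by exists n.
    by exists 0%N => /h.
  apply/countable_injP; exists (fun x => pickle (code x (len x))) => x y.
  rewrite !inE => /lenP x0 /lenP y0 /(pcan_inj pickleK) xy.
  have ll : len x = len y by have := congr1 size xy; rewrite !size_map !size_iota.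
  apply/funext => i; have [lei|ile] := leqP (len x) i; first by rewrite x0 // y0 // -ll.
  apply/val_inj/fi; rewrite ?inE //.
  have := congr1 (fun s => nth 0%N s i) xy; rewrite /code -ll.
  by rewrite !(nth_map 0%N) ?size_iota // nth_iota.
move=> O [x Ox] Oo; have [n nO] : Re_power_nbhs x O by exact: (open_nbhs_nbhs (conj Oo Ox)).
exists (fun i => if (i < n)%N then x i else 0); split.
  by apply: nO => i ->.
by exists n => i ni; rewrite ltnNge ni.
Qed.

Section Metric.
Import Order.TTheory Num.Theory.
Variable K : realType.

Definition Re_power_dist (x y : Re_power) : K :=
  if pselect (exists n, x n != y n) is left h then (ex_minn h).+1%:R^-1 else 0.

Lemma dist_lt (x y : Re_power) n : Re_power_dist x y < n.+1%:R^-1 <-> agree n.+1 x y.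
Proof.
rewrite /Re_power_dist; case: pselect => [h|h].
  case: ex_minnP => m xym mmin.
  rewrite ltf_pV2 ?posrE ?ltr0Sn // ltr_nat ltnS; split=> [nm i|ag].
    rewrite ltnS => lin; apply/eqP; rewrite eq_sym; apply: contraTT nm.
    by move=> /mmin mi; rewrite -leqNgt (leq_trans mi).
  rewrite ltnNge; apply: contra_neqN xym => mn.
  by rewrite ag.
split=> [_ i _|_]; last by rewrite invr_gt0 ltr0Sn.
by apply: contrapT => xy; apply: h; exists i; apply/eqP => xy'; exact: xy (esym xy').
Qed.

Lemma dist_ge0 x y : 0 <= Re_power_dist x y.
Proof. by rewrite /Re_power_dist; case: pselect => [h|_] //; rewrite invr_ge0 ler0n. Qed.

Lemma dist_le x y x' y' : (forall n, agree n.+1 x y -> agree n.+1 x' y') ->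
  Re_power_dist x' y' <= Re_power_dist x y.
Proof.
move=> xy; rewrite {1}/Re_power_dist; case: pselect => [h|_]; last exact: dist_ge0.
case: ex_minnP => m /eqP xym _; rewrite leNgt; apply/negP => /dist_lt/xy ag.
by apply: xym; rewrite ag.
Qed.

Lemma Re_power_complete : completely_metrizable K Re_power_module.
Proof.
have inv_lt (r : K) : 0 < r -> exists n : nat, n.+1%:R^-1 < r.
  move=> r0; exists (Num.bound r^-1).
  rewrite invf_plt ?posrE ?ltr0Sn //.
  apply: (lt_trans (archi_boundP _)); first by rewrite invr_ge0 ltW.
  by rewrite ltr_nat.
have inv0 n : 0 < n.+1%:R^-1 :> K by rewrite invr_gt0 ltr0Sn.
exists Re_power_dist; split.
- split.
  + move=> x y; split=> [d0|->].
      apply/funext => n; have /dist_lt ag : Re_power_dist x y < n.+1%:R^-1 by rewrite d0.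
      by rewrite ag.
    by rewrite /Re_power_dist; case: pselect => // h; exfalso; case: h => n; rewrite eqxx.
  + move=> x y; apply/le_anti/andP.
    by split; apply: dist_le => n ag i lin; rewrite ag.
  + move=> y x z.
    have [le|/ltW le] := leP (Re_power_dist x y) (Re_power_dist y z).
      apply: le_trans (_ : Re_power_dist y z <= _); last by rewrite lerDr dist_ge0.
      apply: dist_le => n yz i lin; rewrite yz //.
      by have /dist_lt -> // := le_lt_trans le (proj2 (dist_lt _ _ _) yz).
    apply: le_trans (_ : Re_power_dist x y <= _); last by rewrite lerDl dist_ge0.
    apply: dist_le => n xy i lin.
    by have /dist_lt -> // := le_lt_trans le (proj2 (dist_lt _ _ _) xy); rewrite xy.
- move=> x U; split=> [[n nU]|[r /inv_lt[n nr] rU]].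
    by exists n.+1%:R^-1 => // y /dist_lt ag; apply: nU => i lin; apply: ag; exact: ltnW.
  by exists n.+1 => y /dist_lt ag; apply: rU; exact: lt_trans nr.
move=> u uC.
have /choice[N NP] n : exists N, forall m, (N <= m)%N -> u m n = u N n.
  have [N NP] := uC _ (inv0 n); exists N => m Nm.
  by have /dist_lt -> // := NP N m (leqnn N) Nm.
exists (fun n => u (N n) n) => U [n nU].
exists (\max_(i < n) N i) => //= m /bigmax_leqP Nm; apply: nU => i lin.
by apply: NP; exact: (Nm (Ordinal lin)).
Qed.

Lemma Re_power_polish : countable [set: R] -> polish K Re_power_module.
Proof. by move=> Rc; split; [exact: Re_power_separable | exact: Re_power_complete]. Qed.
End Metric.

End RePower.

(** * Projectivity of the countable power of [Re] *)

(** [p] lists generators of [Re] over the corner ring and [q] lists generators of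
    the relations between them. *)
Section Projectivity.
Variables (R : nzRingType) (e : nzidempotent R).
Local Notation S := (corner e).
Local Notation ev := (idem_val e).
Local Notation V := (nat -> S^o).
Local Notation A := (topMod_lmod (Re_power_module e)).

Variables (B : set V).
Hypothesis B_basis : is_basis (B : set (V : lmodType S)).

Variables (n m : nat) (p : nat -> R) (q : nat -> nat -> S).
Hypotheses (p_gen : forall x : Re e, exists c : nat -> S,
     (x : R) = \sum_(k < n) p k * (c k : R))
  (p_rel : forall c : nat -> S, \sum_(k < n) p k * (c k : R) = 0 ->
     exists t : nat -> S, forall k, (k < n)%N -> c k = \sum_(l < m) q l k * t l)
  (q_rel : forall l, \sum_(k < n) p k * (q l k : R) = 0).

Lemma corner_val_sum (I : Type) (s : seq I) (F : I -> S) :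
  corner_val (\sum_(i <- s) F i) = \sum_(i <- s) corner_val (F i).
Proof. by elim/big_rec2: _ => [//|i x y _ <-]. Qed.

Lemma corner_val_e (x : S) : ev * (x : R) = (x : R) /\ (x : R) * ev = (x : R).
Proof.
by have [r ->] := corner_valP x; rewrite !mulrA (idemP e) -!mulrA (idemP e).
Qed.

Lemma basis_spanned (y : V) : spanned B y.
Proof.
have [_ /(_ y)[s [c [sB ->]]]] := B_basis.
rewrite big_seq; elim/big_rec: _ => [|x z xs sz]; first exact: spanned0.
by apply: spannedD => //; apply: spannedZ; apply: spanned_base; exact: sB.
Qed.

Definition expansion (a : A) (s : seq V) (c : V -> R) : Prop :=
  [/\ uniq s, forall b, b \in s -> B b, forall b, b \notin s -> c b = 0,
     forall b, c b * ev = c b &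
     forall i, (a i : R) = \sum_(b <- s) c b * corner_val (b i)].

Lemma expansion_linear r a s c a' s' c' : expansion a s c -> expansion a' s' c' ->
  exists t, expansion (r *: a + a') t (fun b => r * c b + c' b).
Proof.
move=> [us sB c0 ce aE] [us' s'B c'0 c'e a'E].
pose t := undup (s ++ s').
have ut : uniq t by exact: undup_uniq.
have ct x : x \notin t -> c x = 0.
  by rewrite mem_undup mem_cat negb_or => /andP[/c0].
have c't x : x \notin t -> c' x = 0.
  by rewrite mem_undup mem_cat negb_or => /andP[_ /c'0].
exists t; split=> //.
- by move=> x; rewrite mem_undup mem_cat => /orP[/sB|/s'B].
- by move=> b bt; rewrite ct // c't // mulr0 addr0.
- by move=> b; rewrite mulrDl -mulrA ce c'e.
move=> i; change (r * (a i : R) + (a' i : R) =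
  \sum_(b <- t) (r * c b + c' b) * corner_val (b i)).
rewrite aE a'E.
rewrite (sum_support (P := R^o) (fun b : V => corner_val (b i)) us ut c0 ct).
rewrite (sum_support (P := R^o) (fun b : V => corner_val (b i)) us' ut c'0 c't).
rewrite mulr_sumr -big_split; apply: eq_bigr => b _.
by rewrite mulrDl mulrA.
Qed.

Lemma expansion_exists a : exists s c, expansion a s c.
Proof.
have /choice[c cP] i := p_gen (a i).
have pRe k (x : S) : p k * (x : R) \in Re_pred e.
  by apply/asboolP; exists (p k * (x : R)); rewrite -mulrA (corner_val_e x).2.
pose ak k : A := fun i => InRe (pRe k (c i k)).
have -> : a = \sum_(k < n) ak k.
  apply/funext => i; apply/val_inj; rewrite /= cP.
  have : forall s : seq 'I_n, \sum_(k <- s) p k * (c i k : R) =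
      ((\sum_(k <- s) ak k : A) i : R).
    by elim=> [|k s IH]; rewrite ?big_nil ?big_cons ?IH.
  by apply.
elim/big_rec: _ => [|k x _ [s' [c' e']]].
  by exists [::], (fun=> 0); split=> // [b|i]; rewrite ?mul0r ?big_nil.
have [s [d [us sB d0 dE]]] := basis_spanned (fun i => c i k).
have ek : expansion (ak k) s (fun b => p k * (d b : R)).
  split=> // [b bs|b|i].
  - by rewrite d0 // mulr0.
  - by rewrite -mulrA (corner_val_e (d b)).2.
  have := congr1 (fun y : V => y i) dE; rewrite /= fct_sumE => h.
  rewrite /= h corner_val_sum mulr_sumr; apply: eq_bigr => b _.
  by rewrite mulrA.
by have [t] := expansion_linear 1 ek e'; rewrite scale1r => et; exists t; eexists; exact: et.
Qed.

(** Write the coefficients through the generators [p].  Then the vanishing of all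
    components yields relations, which are combinations of the relations [q]
    with coefficients in [S^omega].  Expanding these along the independent set
    [B] shows that, for each [b], the coordinates of [c b] through [p] form a
    combination of the relations [q], so that [c b = 0]. *)
Lemma expansion0 s c : expansion 0 s c -> forall b, c b = 0.
Proof.
move=> [us sB c0 ce cE].
have cRe b : c b \in Re_pred e by apply/asboolP; exists (c b).
(* ga b: coordinates of c b through p *)
have /choice[ga gaP] b := p_gen (InRe (cRe b)).
pose ga' b k : S := if b \in s then ga b k else 0.
have rel i : \sum_(k < n) p k * ((\sum_(b <- s) ga' b k * b i : S) : R) = 0.
  transitivity (\sum_(b <- s) c b * corner_val (b i)); last by rewrite -cE.
  under eq_bigr do rewrite corner_val_sum mulr_sumr.
  rewrite exchange_big /= big_seq [RHS]big_seq; apply: eq_bigr => b bs.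
  rewrite [c b]gaP mulr_suml; apply: eq_bigr => k _.
  by rewrite /ga' bs /= mulrA.
(* t i: coordinates through q of the relation found at the index i *)
have /choice[t tP] i := @p_rel (fun k => \sum_(b <- s) ga' b k * b i) (rel i).
have /choice[sp spP] l : exists sd : seq V * (V -> S),
    [/\ uniq sd.1, forall x, x \in sd.1 -> B x, forall x, x \notin sd.1 -> sd.2 x = 0 &
    (fun i => t i l) = \sum_(x <- sd.1) sd.2 x *: x].
  by have [s' [d h]] := basis_spanned (fun i => t i l); exists (s', d).
pose u := undup (s ++ flatten [seq (sp l).1 | l <- iota 0 m]).
have uu : uniq u by exact: undup_uniq.
have uB x : x \in u -> B x.
  rewrite mem_undup mem_cat => /orP[/sB//|/flattenP[_ /mapP[l _ ->]]].
  by have [_ h _ _] := spP l; exact: h.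
have su x : x \notin u -> x \notin s.
  by rewrite mem_undup mem_cat negb_or => /andP[].
have lu l x : (l < m)%N -> x \notin u -> x \notin (sp l).1.
  move=> lm; rewrite mem_undup mem_cat negb_or => /andP[_]; apply: contra => xl.
  by apply/flattenP; exists (sp l).1 => //; apply: map_f; rewrite mem_iota.
have coef k : (k < n)%N -> forall b, b \in u -> ga' b k = \sum_(l < m) q l k * (sp l).2 b.
  move=> kn b bu; apply/eqP; rewrite -subr_eq0; apply/eqP.
  have [indep _] := B_basis.
  apply: (indep u (fun b => ga' b k - \sum_(l < m) q l k * (sp l).2 b)) => //.
  under eq_bigr do rewrite scalerBl.
  rewrite sumrB; apply/eqP; rewrite subr_eq0; apply/eqP.
  have gs x : x \notin s -> ga' x k = 0 by rewrite /ga' => /negbTE ->.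
  have gu x : x \notin u -> ga' x k = 0 by move=> /su /gs.
  rewrite -(sum_support (fun x => x) us uu gs gu).
  transitivity (\sum_(l < m) q l k *: ((fun i => t i l) : V)).
    apply/funext => i; rewrite !fct_sumE; have h := tP i k kn.
    by etransitivity; first exact: h.
  under [RHS]eq_bigr do rewrite scaler_suml.
  rewrite exchange_big; apply: eq_bigr => l _.
  have [ul _ d0 ->] := spP l; rewrite scaler_sumr.
  rewrite (eq_bigr (fun x => (q l k * (sp l).2 x) *: x)); last first.
    by move=> x _; rewrite scalerA.
  apply: sum_support => // x xl; first by rewrite d0 // mulr0.
  by rewrite d0 ?mulr0 //; exact: lu.
move=> b; have [bs|/c0//] := boolP (b \in s).
have bu : b \in u by rewrite mem_undup mem_cat bs.
rewrite [c b]gaP.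
transitivity (\sum_(k < n) \sum_(l < m) p k * (q l k : R) * ((sp l).2 b : R)).
  apply: eq_bigr => k _; have := coef k (ltn_ord k) b bu; rewrite /ga' bs => ->.
  rewrite corner_val_sum mulr_sumr; apply: eq_bigr => l _.
  by rewrite -mulrA.
rewrite exchange_big big1 // => l _.
by rewrite -mulr_suml q_rel mul0r.
Qed.

Lemma expansion_unique a s c s' c' : expansion a s c -> expansion a s' c' ->
  forall b, c b = c' b.
Proof.
move=> h h' b; have [t] := expansion_linear (-1) h h'.
rewrite scaleN1r addNr => /expansion0 /(_ b) /eqP.
by rewrite mulN1r addrC subr_eq0 => /eqP.
Qed.

Lemma Re_power_projective_of_presentation : projective A.
Proof.
have /choice[f fP] (a : A) : exists sc : seq V * (V -> R), expansion a sc.1 sc.2.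
  by have [s [c h]] := expansion_exists a; exists (s, c).
pose v (b : V) : A := fun i => corner_Re (b i).
apply: (@dual_basis_projective R A V v (fun b a => (f a).2 b) (fun a => (f a).1)).
- move=> b r x y; have [t h] := expansion_linear r (fP x) (fP y).
  exact: expansion_unique (fP _) h b.
- by move=> a; have [] := fP a.
- by move=> b a; have [_ _ h _ _] := fP a; exact: h.
move=> a; have [_ _ _ _ aE] := fP a.
apply/funext => i; apply/val_inj; rewrite [LHS]aE.
have : forall s : seq V, \sum_(b <- s) (f a).2 b * corner_val (b i) =
    ((\sum_(b <- s) (f a).2 b *: v b : A) i : R).
  by elim=> [|b s IH]; rewrite ?big_nil ?big_cons ?IH.
by apply.
Qed.

End Projectivity.

Lemma Re_power_projective (R : nzRingType) (e : nzidempotent R) :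
  left_F_ring (corner e) -> finitely_presented (Re e) ->
  projective (topMod_lmod (Re_power_module e)).
Proof.
move=> [B B_basis] [m [n [g [f [f_surj f_ker]]]]].
pose del N k : 'rV[(corner e)^c]_N := \row_j ((j == k :> nat)%:R).
have row_del N (x : 'rV[(corner e)^c]_N) : x = \sum_(k < N) x 0 k *: del N k.
  apply/rowP => j; rewrite summxE (bigD1 j) //= big1 => [|k kj].
    by rewrite !mxE eqxx mulr1 addr0.
  by rewrite !mxE (_ : (j == k :> nat) = false) ?mulr0 //; apply/negbTE; rewrite eq_sym.
pose p k : R := f (del n k).
pose q l k : corner e := if insub k is Some k' then g (del m l) 0 k' else 0.
have qE l (k : 'I_n) : q l k = g (del m l) 0 k by rewrite /q valK.
have ReSum (I : Type) (s : seq I) (F : I -> Re e) :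
    (\sum_(i <- s) F i : Re e) = \sum_(i <- s) (F i : R) :> R.
  by elim/big_rec2: _ => [//|i x y _ <-].
have fE x : (f x : R) = \sum_(k < n) p k * corner_val (x 0 k).
  by rewrite {1}[x]row_del linear_sum ReSum; apply: eq_bigr => k _; rewrite linearZ.
apply: (@Re_power_projective_of_presentation R e B B_basis n m p q).
- move=> x; have [y <-] := f_surj x; rewrite fE.
  exists (fun k => if insub k is Some k' then y 0 k' else 0).
  by apply: eq_bigr => k _; rewrite valK.
- move=> c c0.
  have /f_ker[z zE] : f (\row_(k < n) (c k : (corner e)^c)) = 0.
    apply/val_inj; rewrite /= fE -[RHS]c0; apply: eq_bigr => k _.
    by rewrite mxE.
  exists (fun l => if insub l is Some l' then z 0 l' else 0) => k kn.
  have := congr1 (fun x : 'rV_n => x 0 (Ordinal kn)) zE; rewrite mxE => <-.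
  rewrite {1}[z]row_del linear_sum summxE; apply: eq_bigr => l _.
  by rewrite linearZ mxE valK -(qE l (Ordinal kn)).
- move=> l.
  have : f (g (del m l)) = 0 by apply/f_ker; exists (del m l).
  move=> /(congr1 val) /=; rewrite fE => h; rewrite -[RHS]h.
  by apply: eq_bigr => k _; rewrite qE.
Qed.

(** * The four conditions are equivalent *)

Theorem theorem1p5 (K : realType) (R : nzRingType)
    (R_countable : countable [set: R]) :
  [<->
    exists A : topologicalModule R,
      [/\ polish K A, ~ countable [set: A] & projective (topMod_lmod A)];
    exists e : nzidempotent R,
      irreducible_idempotent (e : R) /\ finite_length (Re e);
    exists e : nzidempotent R,
      [/\ irreducible_idempotent (e : R), right_artinian (corner e)
        & finite_length (Re e)];
    exists e : nzidempotent R,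
      left_F_ring (corner e) /\ finitely_presented (Re e)
  ].
Proof.
tfae.
- by move=> [A [Apol Aunc Aproj]]; exact: polish_finite_length Apol Aunc Aproj.
- by move=> [e [e_irr e_fl]]; exists e; split=> //; exact: corner_artinian.
- move=> [e [e_irr e_art e_fl]]; exists e; exact: finite_length_corner.
- move=> [e [e_free e_fp]]; exists (Re_power_module e); split.
  + exact: Re_power_polish.
  + exact: Re_power_uncountable.
  + exact: Re_power_projective.
Qed.
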